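(* Let $m=2n$ be even with $n\ge 2$, and let $A\in Z_m([a,b])$ be a Shin--Zettl matrix of order $m$ on the finite interval $[a,b]$ with $A=A^+$ whose entries are real-valued. Let $L_{\min}$, $L_{\max}$ be the associated minimal and maximal operators in $L_2([a,b],\mathbb{C})$. For a linear operator (matrix) $K$ on $\mathbb{C}^m$ let $L_K$ and $L^K$ be the restrictions of $L_{\max}$ to the sets of $y\in\operatorname{Dom}(L_{\max})$ satisfying respectively $$(K-I)\Gamma_{[1]}y+i(K+I)\Gamma_{[2]}y=0\quad\text{(for }L_K),\qquad (K-I)\Gamma_{[1]}y-i(K+I)\Gamma_{[2]}y=0\quad\text{(for }L^K).$$ Then: (i) The operators $L_{\max}$ and $L_{\min}$ are real. (ii) All real maximal dissipative and all real maximal accumulative extensions of $L_{\min}$ are self-adjoint. (iii) A self-adjoint extension $L_K$ (respectively $L^K$), $K$ unitary, is real if and only if the unitary matrix $K$ is symmetric, i.e. $K=K^T$.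
   Context: Shin--Zettl matrices. $Z_m([a,b])$ is the set of $m\times m$ complex matrix-valued functions $A=(a_{k,s})$ on the finite interval $[a,b]$ such that $a_{k,s}\equiv 0$ for $s>k+1$, all entries $a_{k,s}\in L_1([a,b],\mathbb{C})$, and $a_{k,k+1}\ne 0$ a.e. on $[a,b]$ for $k=1,\dots,m-1$. Quasi-derivatives. Given $A$, define recursively $D^{[0]}y:=y$; $D^{[k]}y:=a_{k,k+1}^{-1}\bigl((D^{[k-1]}y)'-\sum_{s=1}^k a_{k,s}D^{[s-1]}y\bigr)$ for $k=1,\dots,m-1$; $D^{[m]}y:=(D^{[m-1]}y)'-\sum_{s=1}^m a_{m,s}D^{[s-1]}y$, on $\operatorname{Dom}(A):=\{y : D^{[k]}y\in AC([a,b],\mathbb{C}),\ k=0,\dots,m-1\}$. The quasi-differential expression is $l(y):=i^mD^{[m]}y$. Operators in $L_2([a,b],\mathbb{C})$. $L_{\max}y=l(y)$ with $\operatorname{Dom}(L_{\max})=\{y\in\operatorname{Dom}(A): D^{[m]}y\in L_2([a,b],\mathbb{C})\}$; $L_{\min}$ is the restriction of $L_{\max}$ to $\{y\in\operatorname{Dom}(L_{\max}): D^{[k]}y(a)=D^{[k]}y(b)=0,\ k=0,\dots,m-1\}$. Formal adjoint. $A^+:=-\Lambda_m^{-1}\overline{A^T}\Lambda_m$, where $\Lambda_m$ is the $m\times m$ matrix whose only non-zero entries are $(\Lambda_m)_{j,m+1-j}=(-1)^j$, $j=1,\dots,m$. When $A=A^+$ it is known that $L_{\min}$ is closed, densely defined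 and symmetric with deficiency indices $(m,m)$, and $L_{\min}^*=L_{\max}$, $L_{\max}^*=L_{\min}$. Boundary maps $\Gamma_{[1]},\Gamma_{[2]}:\operatorname{Dom}(L_{\max})\to\mathbb{C}^{2n}$: for $k=1,\dots,n$, $(\Gamma_{[1]}y)_k=i^{2n}(-1)^kD^{[2n-k]}y(a)$, $(\Gamma_{[1]}y)_{n+k}=i^{2n}(-1)^{k-1}D^{[2n-k]}y(b)$, $(\Gamma_{[2]}y)_k=D^{[k-1]}y(a)$, $(\Gamma_{[2]}y)_{n+k}=D^{[k-1]}y(b)$. Dissipativity. A densely defined linear operator $T$ in a Hilbert space $\mathcal{H}$ (inner product linear in the first argument) is dissipative (resp. accumulative) if $\operatorname{Im}(Tf,f)\ge0$ (resp. $\le0$) for all $f\in\operatorname{Dom}(T)$; it is maximal dissipative (resp. maximal accumulative) if in addition it has no non-trivial dissipative (resp. accumulative) extension in $\mathcal{H}$. Real operators. A linear operator $L$ in $L_2([a,b],\mathbb{C})$ is called real if for every $f\in\operatorname{Dom}(L)$ the complex conjugate $\overline f$ also lies in $\operatorname{Dom}(L)$ and $L(\overline f)=\overline{L(f)}$. *)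

(* Defs.v *)
From HB Require Import structures.
From mathcomp Require Import all_boot all_order all_algebra.
From mathcomp Require Import spectral ring_quotient.
From mathcomp Require Import all_classical all_reals all_analysis.
From mathcomp Require Import measurable_realfun.
From mathcomp Require Import ring lra.
From mathcomp Require Import complex.
Set Implicit Arguments.
Unset Strict Implicit.
Unset Printing Implicit Defensive.
Import Order.TTheory GRing.Theory Num.Theory.
Import numFieldNormedType.Exports.

Local Open Scope classical_set_scope.
Local Open Scope ring_scope.
Local Open Scope quotient_scope.
Local Open Scope complex_scope.

Local Notation Re := complex.Re.
Local Notation Im := complex.Im.

(* A (possibly unbounded) operator in H is represented by its graph, a subset
   of H * H; an extension is then an inclusion of graphs. The inner product ip
   is meant to be linear in its first argument. *)
Section Operators.
Context {R : rcfType} {H : lmodType R[i]} (ip : H -> H -> R[i]).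
Implicit Types S T : set (H * H).

Definition linear_operator T : Prop :=
  [/\ T (0, 0),
      (forall (c : R[i]) f1 g1 f2 g2, T (f1, g1) -> T (f2, g2) ->
         T (c *: f1 + f2, c *: g1 + g2))
    & (forall f g1 g2, T (f, g1) -> T (f, g2) -> g1 = g2)].

Definition op_dom T : set H := [set f | exists g, T (f, g)].

Definition ip_norm (f : H) : R := Num.sqrt (Re (ip f f)).

Definition densely_defined T : Prop :=
  forall (f : H) (e : R), 0 < e -> exists2 g, op_dom T g & ip_norm (f - g) < e.

Definition op_adjoint T : set (H * H) :=
  [set p | forall f g, T (f, g) -> ip g p.1 = ip f p.2].

Definition self_adjoint T : Prop :=
  [/\ linear_operator T, densely_defined T & op_adjoint T = T].

Definition dissipative T : Prop :=
  [/\ linear_operator T, densely_defined T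
    & forall f g, T (f, g) -> 0 <= Im (ip g f)].

Definition accumulative T : Prop :=
  [/\ linear_operator T, densely_defined T
    & forall f g, T (f, g) -> Im (ip g f) <= 0].

Definition max_dissipative T : Prop :=
  dissipative T /\ forall S, dissipative S -> T `<=` S -> S = T.

Definition max_accumulative T : Prop :=
  accumulative T /\ forall S, accumulative S -> T `<=` S -> S = T.

End Operators.

Section FunctionSpaces.
Context {R : realType}.
Implicit Types (a b : R) (f g : R -> R[i]).

Local Notation mu := (@lebesgue_measure R).

Definition L1_fun a b f : Prop :=
  mu.-integrable `[a, b] (fun x => (Re (f x))%:E) /\
  mu.-integrable `[a, b] (fun x => (Im (f x))%:E).

Definition L2_fun a b f : Prop :=
  [/\ measurable_fun `[a, b] (fun x => Re (f x)),
      measurable_fun `[a, b] (fun x => Im (f x))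
    & mu.-integrable `[a, b] (fun x => (Re (f x) ^+ 2 + Im (f x) ^+ 2)%:E)].

Definition cintegral a b f : R[i] :=
  (\int[mu]_(x in `[a, b]) Re (f x)) +i* (\int[mu]_(x in `[a, b]) Im (f x)).

Definition abs_continuous a b f : Prop :=
  forall e : R, 0 < e -> exists2 d : R, 0 < d &
    forall (N : nat) (u v : 'I_N -> R),
      (forall j, [/\ a <= u j, u j <= v j & v j <= b]) ->
      trivIset [set: 'I_N] (fun j => [set` `]u j, v j[]) ->
      \sum_j (v j - u j) < d ->
      \sum_j `|f (v j) - f (u j)| < e%:C.

Definition cderiv f (x : R) : R[i] :=
  derive1 (fun t => Re (f t)) x +i* derive1 (fun t => Im (f t)) x.

Lemma L2_fun_cst0 a b : L2_fun a b (fun=> 0).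
Proof.
split; [exact: measurable_cst | exact: measurable_cst |].
rewrite /= expr0n /= addr0; exact: integrable0.
Qed.

Lemma L2_funP a b f (mR : measurable_fun `[a, b] (fun x => Re (f x)))
    (mI : measurable_fun `[a, b] (fun x => Im (f x))) :
  measurable_fun `[a, b] (fun x => Re (f x) ^+ 2 + Im (f x) ^+ 2).
Proof.
by apply: measurable_funD; apply: measurable_funX.
Qed.

Lemma L2_fun_lin a b (c : R[i]) f g : L2_fun a b f -> L2_fun a b g ->
  L2_fun a b (fun x => c * f x + g x).
Proof.
case=> mRf mIf If [mRg mIg Ig].
have EQ x : c * f x + g x =
    (Re c * Re (f x) - Im c * Im (f x) + Re (g x)) +i*
    (Re c * Im (f x) + Im c * Re (f x) + Im (g x)).
  by case: c (f x) (g x) => [? ?] [? ?] [? ?].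
have mR : measurable_fun `[a, b] (fun x => Re (c * f x + g x)).
  rewrite (_ : (fun x => _) = (fun x => Re c * Re (f x) - Im c * Im (f x)
    + Re (g x))); last by apply/funext => x; rewrite EQ.
  apply: measurable_funD => //; apply: measurable_funB;
    exact: measurable_funM.
have mI : measurable_fun `[a, b] (fun x => Im (c * f x + g x)).
  rewrite (_ : (fun x => _) = (fun x => Re c * Im (f x) + Im c * Re (f x)
    + Im (g x))); last by apply/funext => x; rewrite EQ.
  apply: measurable_funD => //; apply: measurable_funD;
    exact: measurable_funM.
split=> //.
pose K : R := 2 * (Re c ^+ 2 + Im c ^+ 2).
have IK : mu.-integrable `[a, b] (fun x =>
    (K%:E * (Re (f x) ^+ 2 + Im (f x) ^+ 2)%:E
     + 2%:E * (Re (g x) ^+ 2 + Im (g x) ^+ 2)%:E)%E).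
  by apply: integrableD => //; exact: integrableZl.
apply: (le_integrable _ _ _ IK) => //; first by apply/measurable_EFinP; exact: L2_funP.
move=> x _.
rewrite -!EFinM -EFinD !gee0_abs ?lee_fin ?EQ /=; first last.
- by rewrite addr_ge0 ?sqr_ge0.
- by rewrite /K !addr_ge0 ?mulr_ge0 ?addr_ge0 ?sqr_ge0.
rewrite /K.
set p := Re c; set q := Im c; set s := Re (f x); set t := Im (f x).
set u := Re (g x); set v := Im (g x).
have := sqr_ge0 (p * s - q * t - u); have := sqr_ge0 (p * t + q * s - v).
nra.
Qed.

Lemma L2_fun_conj a b f : L2_fun a b f -> L2_fun a b (fun x => conjc (f x)).
Proof.
case=> mR mI If.
have ER : (fun x => Re (conjc (f x))) = (fun x => Re (f x)).
  by apply/funext => x; case: (f x).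
have EI : (fun x => Im (conjc (f x))) = (fun x => - Im (f x)).
  by apply/funext => x; case: (f x).
split; rewrite ?ER ?EI //; first exact: measurable_funN.
rewrite (_ : (fun x => _) = (fun x => (Re (f x) ^+ 2 + Im (f x) ^+ 2)%:E)) //.
by apply/funext => x; case: (f x) => u v /=; rewrite sqrrN.
Qed.

End FunctionSpaces.

(* The Hilbert space L2 a b is the quotient of the square-integrable functions
   by almost-everywhere equality on [a, b]. *)
Section L2Space.
Context {R : realType} (a b : R).

Local Notation mu := (@lebesgue_measure R).

Definition L2_pred : {pred (R -> R[i]^o)} :=
  fun f => `[< L2_fun a b (f : R -> R[i]) >].

Lemma L2_submod_closed : submod_closed L2_pred.
Proof.
split; first by apply/asboolP; exact: L2_fun_cst0.
by move=> c f g /asboolP Lf /asboolP Lg; apply/asboolP; exact: L2_fun_lin.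
Qed.

HB.instance Definition _ :=
  GRing.isSubmodClosed.Build R[i] (R -> R[i]^o) L2_pred L2_submod_closed.

Record L2func := MkL2func {
  L2func_val :> R -> R[i]^o ;
  L2func_in : L2func_val \in L2_pred }.

HB.instance Definition _ := [isSub for L2func_val].
HB.instance Definition _ := [Choice of L2func by <:].
HB.instance Definition _ := [SubChoice_isSubLmodule of L2func by <:].

Definition L2_null : {pred L2func} :=
  fun f => `[< ae_eq mu `[a, b]%classic (f : R -> R[i]) (fun=> 0) >].

Lemma L2_null_zmod_closed : zmod_closed L2_null.
Proof.
split; first by apply/asboolP; exact: ae_eq_refl.
move=> f g /asboolP f0 /asboolP g0; apply/asboolP.
apply: filterS2 f0 g0 => x f0 g0 Dx.
by rewrite [LHS](_ : _ = f x - g x) // f0 // g0 // subr0.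
Qed.

HB.instance Definition _ :=
  GRing.isZmodClosed.Build L2func L2_null L2_null_zmod_closed.

Definition L2 : Type := Quotient.quot L2_null.
HB.instance Definition _ := EqQuotient.on L2.
HB.instance Definition _ := GRing.Zmodule.on L2.

Definition L2_scale (c : R[i]) (u : L2) : L2 := \pi_L2 (c *: repr u).

Lemma L2_piP (f g : L2func) : (\pi_L2 f = \pi_L2 g) <->
  ae_eq mu `[a, b]%classic (f : R -> R[i]) (g : R -> R[i]).
Proof.
have E x : (f - g : L2func) x = f x - g x by [].
split=> [/eqP|fg].
  rewrite -Quotient.idealrBE => /asboolP.
  apply: filterS => x h /h.
  by rewrite E => /eqP; rewrite subr_eq0 => /eqP.
apply/eqP; rewrite -Quotient.idealrBE; apply/asboolP.
by apply: filterS fg => x h /h; rewrite E => ->; rewrite subrr.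
Qed.

Lemma L2_scale_pi c f : L2_scale c (\pi_L2 f) = \pi_L2 (c *: f).
Proof.
apply/L2_piP.
have /L2_piP : \pi_L2 (repr (\pi_L2 f)) = \pi_L2 f by rewrite reprK.
by apply: filterS => x h Dx; congr (c * _); exact: h.
Qed.

Lemma L2_piD (f g : L2func) : \pi_L2 (f + g) = \pi_L2 f + \pi_L2 g.
Proof. exact: Quotient.pi_add. Qed.

Fact L2_scaleA c d (u : L2) : L2_scale c (L2_scale d u) = L2_scale (c * d) u.
Proof. by rewrite -[u]reprK (L2_scale_pi d) !L2_scale_pi scalerA. Qed.

Fact L2_scale1 : left_id 1 L2_scale.
Proof. by move=> u; rewrite -[u]reprK L2_scale_pi scale1r. Qed.

Fact L2_scaleDr : right_distributive L2_scale +%R.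
Proof.
move=> c u v; rewrite -[u]reprK -[v]reprK -L2_piD !L2_scale_pi scalerDr.
exact: L2_piD.
Qed.

Fact L2_scaleDl (u : L2) : {morph L2_scale^~ u : c d / c + d}.
Proof.
by move=> c d; rewrite -[u]reprK !L2_scale_pi scalerDl L2_piD.
Qed.

HB.instance Definition _ := GRing.Zmodule_isLmodule.Build R[i] L2
  L2_scaleA L2_scale1 L2_scaleDr L2_scaleDl.

Definition L2_fun_of (u : L2) : R -> R[i] := L2func_val (repr u).

Definition L2_class (u : L2) (f : R -> R[i]) : Prop :=
  ae_eq mu `[a, b]%classic (L2_fun_of u) f.

Definition L2_ip (u v : L2) : R[i] :=
  cintegral a b (fun x => L2_fun_of u x * conjc (L2_fun_of v x)).

Lemma L2_conj_subproof (f : L2func) :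
  ((fun x => conjc (f x : R[i])) : R -> R[i]^o) \in L2_pred.
Proof. by apply/asboolP/L2_fun_conj/asboolP; exact: L2func_in. Qed.

Definition L2_conj (u : L2) : L2 := \pi_L2 (MkL2func (L2_conj_subproof (repr u))).

Definition real_operator (T : set (L2 * L2)) : Prop :=
  linear_operator T /\
  forall f g, T (f, g) -> T (L2_conj f, L2_conj g).

End L2Space.

(* Row and column indices of matrices start at 0: the coefficient a_{k,s} of
   the usual notation is the entry (k-1, s-1) of A. *)
Section ShinZettl.
Context {R : realType} (a b : R).

Local Notation mu := (@lebesgue_measure R).

Section AnyOrder.
Context {m : nat}.
Implicit Types (A : R -> 'M[R[i]]_m) (y : R -> R[i]).

Definition shin_zettl A : Prop :=
  [/\ (forall k s : 'I_m, (k.+1 < s)%N ->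
         ae_eq mu `[a, b]%classic (fun x => A x k s) (fun=> 0)),
      (forall k s : 'I_m, L1_fun a b (fun x => A x k s))
    & (forall k s : 'I_m, s = k.+1 :> nat ->
         {ae mu, forall x, `[a, b]%classic x -> A x k s != 0})].

Definition Lambda_mx : 'M[R[i]]_m :=
  \matrix_(j, k) (if (j + k).+1 == m then (-1) ^+ j.+1 else 0).

Definition formal_adjoint A (x : R) : 'M[R[i]]_m :=
  - (invmx Lambda_mx *m map_mx conjc (A x)^T *m Lambda_mx).

Definition formally_self_adjoint A : Prop :=
  ae_eq mu `[a, b]%classic A (formal_adjoint A).

Definition real_entries A : Prop :=
  forall k s : 'I_m,
    ae_eq mu `[a, b]%classic (fun x => Im (A x k s)) (fun=> 0).

Definition entry A (k s : nat) (x : R) : R[i] :=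
  match insub k, insub s with
  | Some i, Some j => A x i j
  | _, _ => 0
  end.

(* A function with entries in L_1 only determines its quasi-derivatives almost
   everywhere; D^[k]y for 0 < k < m is taken to be the absolutely continuous
   function in its class, so that its point values and derivative make sense.
   If there is none, y is not in Dom(A). *)
Definition ac_representative (f : R -> R[i]) : R -> R[i] :=
  xget f [set g | abs_continuous a b g /\ ae_eq mu `[a, b]%classic g f].

(* With d = [:: D^[0]y; ...; D^[k]y],
   qd_remainder A k d = (D^[k]y)' - \sum_(s <= k) a_{k+1,s+1} D^[s]y. *)
Definition qd_remainder A (k : nat) (d : seq (R -> R[i])) (x : R) : R[i] :=
  cderiv (nth (fun=> 0) d k) x
  - \sum_(s < k.+1) entry A k s x * nth (fun=> 0) d s x.

Fixpoint quasi_derivs A y (k : nat) : seq (R -> R[i]) :=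
  if k is k'.+1 then
    let d := quasi_derivs A y k' in
    rcons d (ac_representative
      (fun x => (entry A k' k'.+1 x)^-1 * qd_remainder A k' d x))
  else [:: y].

Definition quasi_deriv A (k : nat) y : R -> R[i] :=
  if (k < m)%N then nth (fun=> 0) (quasi_derivs A y k) k
  else qd_remainder A m.-1 (quasi_derivs A y m.-1).

Definition qd_dom A : set (R -> R[i]) :=
  [set y | forall k, (k < m)%N -> abs_continuous a b (quasi_deriv A k y)].

Definition qd_expr A y (x : R) : R[i] := 'i%C ^+ m * quasi_deriv A m y x.

Definition max_dom A : set (R -> R[i]) :=
  [set y | qd_dom A y /\ L2_fun a b (quasi_deriv A m y)].

Definition min_dom A : set (R -> R[i]) :=
  [set y | max_dom A y /\ forall k, (k < m)%N ->
     quasi_deriv A k y a = 0 /\ quasi_deriv A k y b = 0].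

Definition qd_operator A (D : set (R -> R[i])) : set (L2 a b * L2 a b) :=
  [set p | exists2 y, D y & L2_class p.1 y /\ L2_class p.2 (qd_expr A y)].

Definition L_max A := qd_operator A (max_dom A).

Definition L_min A := qd_operator A (min_dom A).

End AnyOrder.

Section EvenOrder.
Context {n : nat}.
Implicit Types (A : R -> 'M[R[i]]_(n + n)) (K : 'M[R[i]]_(n + n)).

Definition Gamma1 A (y : R -> R[i]) : 'cV[R[i]]_(n + n) :=
  col_mx
    (\col_(k < n) ('i%C ^+ (n + n) * (-1) ^+ k.+1 *
                   quasi_deriv A (n + n - k.+1) y a))
    (\col_(k < n) ('i%C ^+ (n + n) * (-1) ^+ k *
                   quasi_deriv A (n + n - k.+1) y b)).

Definition Gamma2 A (y : R -> R[i]) : 'cV[R[i]]_(n + n) :=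
  col_mx (\col_(k < n) quasi_deriv A k y a) (\col_(k < n) quasi_deriv A k y b).

Definition L_sub A K := qd_operator A
  [set y | max_dom A y /\
     (K - 1%:M) *m Gamma1 A y + 'i%C *: ((K + 1%:M) *m Gamma2 A y) = 0].

Definition L_sup A K := qd_operator A
  [set y | max_dom A y /\
     (K - 1%:M) *m Gamma1 A y - 'i%C *: ((K + 1%:M) *m Gamma2 A y) = 0].

End EvenOrder.
End ShinZettl.

Arguments L2_ip {R} a b u v.
Arguments shin_zettl {R} a b {m} A.
Arguments formally_self_adjoint {R} a b {m} A.
Arguments real_entries {R} a b {m} A.
Arguments L_max {R} a b {m} A.
Arguments L_min {R} a b {m} A.
Arguments L_sub {R} a b {n} A K.
Arguments L_sup {R} a b {n} A K.

(* Main.v *)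
Require Import Defs.
From HB Require Import structures.
From mathcomp Require Import all_boot all_order all_algebra.
From mathcomp Require Import spectral ring_quotient.
From mathcomp Require Import all_classical all_reals all_analysis.
From mathcomp Require Import measurable_realfun.
From mathcomp Require Import ring lra.
From mathcomp Require Import complex.
Set Implicit Arguments.
Unset Strict Implicit.
Unset Printing Implicit Defensive.
Import Order.TTheory GRing.Theory Num.Theory.
Import numFieldNormedType.Exports.
Local Open Scope classical_set_scope.
Local Open Scope ring_scope.
Local Open Scope complex_scope.

(**
  Writing a function and its quasi-derivatives as a first-order linear system
  with integrable coefficients, three facts carry the proof. First, absolutely
  continuous functions are almost everywhere derivable and are the integrals of
  their derivatives (their total variation is absolutely continuous, so its
  Lebesgue-Stieltjes measure has a Radon-Nikodym density); hence the
  quasi-derivatives are linear in the function, and they commute with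
  conjugation because the coefficients are real. Second, a real dissipative
  operator T is symmetric, since the imaginary parts of (Tf, f) for f and for
  its conjugate are opposite. If (h, k) is in the graph of T* with
  Im (k, h) >= 0, then T extended by h |-> k is dissipative, so maximality puts
  (h, k) in T; otherwise the same applies to the conjugate of (h, k). Thus
  T* = T. Third, the boundary values of the quasi-derivatives at a and b are
  arbitrary. The boundary values of functions in Dom(L_K) are therefore all the
  pairs (i(K + I)w, -(K - I)w), and this set is stable under conjugation if and
  only if K conj(K) = I, which for a unitary K means K = K^T.
*)

(** * Absolutely continuous functions *)

Section AbsolutelyContinuous.
Context {R : realType}.
Implicit Types (a b : R) (f g : R -> R) (s t : seq (R * R)).

Local Notation mu := (@lebesgue_measure R).

(** The obstacle is that [quasi_deriv] is defined by recursive choice: each quasi-derivative of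
    order strictly between 0 and [m] is a representative picked by [xget], with which nothing can be
    computed directly. All algebra is therefore done on [quasi_system], a relation between arbitrary
    families of functions; [quasi_system_realized] and [quasi_system_uniq] translate back. A second
    obstacle is measurability: the quasi-derivative of order [m] contains [derive1] of a function
    derivable only almost everywhere, and Borel measurability does not pass along almost everywhere
    equality. This is why derivatives are shown to be Borel functions. Arbitrary boundary values
    come from control theory: the quasi-derivative of order [m] is regarded as a control acting on
    the last equation, and the nonvanishing superdiagonal makes the system controllable. The four
    operators differ only in a condition [P] on boundary values, so linearity and realness are
    proved once for an abstract [P]. *)

Definition nonoverlapping (p q : R * R) := (p.2 <= q.1) || (q.2 <= p.1).

Definition subintervals a b s :=
  all (fun p => [&& a <= p.1, p.1 <= p.2 & p.2 <= b]) s &&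
  pairwise nonoverlapping s.

Definition total_length s : R := \sum_(p <- s) (p.2 - p.1).

Definition total_increment f s : R := \sum_(p <- s) `|f p.2 - f p.1|.

(** Lists of pairs replace the families indexed by ['I_N] of [abs_continuous], so that refining an
    interval by a partition becomes a concatenation. *)
Definition ac a b f := forall e : R, 0 < e -> exists2 d : R, 0 < d &
  forall s, subintervals a b s -> total_length s < d -> total_increment f s < e.

Lemma abs_continuous_ac a b (f : R -> R[i]) (h : R[i] -> R) :
  (forall z w, `|h z - h w|%:C <= `|z - w|) ->
  abs_continuous a b f -> ac a b (h \o f).
Proof.
move=> hle fac e e0; have [d d0 fd] := fac _ e0; exists d => // s.
move=> /andP[/(all_nthP (0, 0)) sab /(pairwiseP (0, 0)) sp] sd.
have := fd (size s) (fun j => (nth (0, 0) s j).1) (fun j => (nth (0, 0) s j).2).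
rewrite /total_length (big_nth (0, 0)) big_mkord in sd.
rewrite -[_ < e]ltcR.
move=> H; apply: le_lt_trans (H _ _ sd).
- rewrite /total_increment (big_nth (0, 0)) big_mkord rmorph_sum /=.
  by apply: ler_sum => i _; exact: hle.
- by move=> j; have /and3P[] := sab _ (ltn_ord j).
- have aux (i j : 'I_(size s)) x : (i < j)%N ->
     x \in `](nth (0, 0) s i).1, (nth (0, 0) s i).2[ ->
     x \in `](nth (0, 0) s j).1, (nth (0, 0) s j).2[ -> False.
    move=> ij; rewrite !in_itv /= => /andP[x1 x2] /andP[x3 x4].
    have /orP[h1|h1] := sp _ _ (ltn_ord i) (ltn_ord j) ij.
      by have := lt_trans (lt_le_trans x2 h1) x3; rewrite ltxx.
    by have := lt_trans (lt_le_trans x4 h1) x1; rewrite ltxx.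
  move=> i j _ _ [x [/= xi xj]].
  case: (ltngtP i j) => [ij|ji|/val_inj //].
    by have := aux _ _ _ ij xi xj.
  by have := aux _ _ _ ji xj xi.
Qed.

Definition partition_pairs (u : R) (p : seq R) := zip (u :: p) p.

Lemma variation_pairs u v f p : itv_partition u v p ->
  variation u v f p = total_increment f (partition_pairs u p).
Proof.
move=> /variation_zip ->; rewrite /total_increment /partition_pairs.
by elim: p u => [|x p IH] u; rewrite ?big_nil// !big_cons /= IH.
Qed.

Lemma total_length_partition u v p : itv_partition u v p ->
  total_length (partition_pairs u p) = v - u.
Proof.
rewrite /total_length /partition_pairs.
elim: p u => [|x p IH] u; first by move/itv_partition_nil ->; rewrite big_nil subrr.
by move=> /itv_partition_cons /IH E; rewrite big_cons /= E; lra.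
Qed.

Lemma partition_pairs_in u v p : itv_partition u v p ->
  all (fun q => [&& u <= q.1, q.1 <= q.2 & q.2 <= v]) (partition_pairs u p) &&
  pairwise nonoverlapping (partition_pairs u p).
Proof.
rewrite /partition_pairs; elim: p u => // x p IH u uxp.
have ux : u <= x by case: uxp => /= /andP[/ltW].
have xp := itv_partition_cons uxp; have xv := itv_partition_le xp.
have /andP[xall xpw] := IH _ xp; rewrite /= lexx ux xv /=.
rewrite xpw andbT; apply/andP; split.
  by apply: sub_all xall => q /and3P[xq -> ->]; rewrite (le_trans ux xq).
by apply: sub_all xall => q /and3P[xq _ _]; rewrite /nonoverlapping /= xq.
Qed.

Lemma nonoverlapping_sub (p q r : R * R) :
  p.1 <= q.1 -> q.2 <= p.2 -> nonoverlapping p r -> nonoverlapping q r.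
Proof.
move=> pq qp; rewrite /nonoverlapping => /orP[h|h].
  by rewrite (le_trans qp h).
by rewrite (le_trans h pq) orbT.
Qed.

Lemma nonoverlappingC p q : nonoverlapping p q = nonoverlapping q p.
Proof. by rewrite /nonoverlapping orbC. Qed.

Local Notation TV := total_variation.

(** Replacing an interval by the pairs of a partition of it keeps the total length, so the bound on
    increments survives the refinement; the supremum over partitions then turns an increment into a
    variation. The second list [t] holds the intervals already refined and makes the induction on
    [s] possible. *)
Lemma ac_sum_total_variation a b f (e d : R) :
  (forall s, subintervals a b s -> total_length s < d ->
     total_increment f s < e) ->
  forall s t, subintervals a b (s ++ t) -> total_length (s ++ t) < d ->
    (\sum_(p <- s) TV p.1 p.2 f + (total_increment f t)%:E <= e%:E)%E.
Proof.
move=> fd; elim=> [|[u v] s IH] t.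
  by move=> tab td; rewrite big_nil add0e lee_fin ltW// fd.
rewrite big_cons /subintervals /= => /andP[/andP[/and3P[au uv vb] stab]].
move=> /andP[stuv stp] lst.
set S := (\sum_(j <- s) _)%E.
have S0 : (0 <= S)%E.
  rewrite /S big_seq; apply: sume_ge0 => p ps; apply: total_variation_ge0.
  by move: stab; rewrite all_cat => /andP[/allP /(_ _ ps) /and3P[]].
have key w : variations u v f w ->
    (S + (w + total_increment f t)%:E <= e%:E)%E.
  case=> p uvp <-.
  have /andP[pall ppw] := partition_pairs_in uvp.
  have := IH (partition_pairs u p ++ t); rewrite {1}/total_increment big_cat /=.
  rewrite -/(total_increment _ _) -/(total_increment f t).
  rewrite -(variation_pairs _ uvp); apply.
    have sub r : nonoverlapping (u, v) r ->
        all (nonoverlapping^~ r) (partition_pairs u p).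
      move=> uvr; apply: sub_all pall => q /and3P[uq _ qv].
      exact: nonoverlapping_sub uvr.
    apply/andP; split.
      move: stab; rewrite !all_cat => /andP[-> ->] /=; rewrite andbT.
      apply: sub_all pall => q /and3P[uq -> qv].
      by rewrite (le_trans au uq) (le_trans qv vb).
    move: stp stuv; rewrite !pairwise_cat all_cat ppw /=.
    move=> /and3P[st -> ->] /andP[suv tuv]; rewrite /= andbT allrel_catr st andbT.
    apply/andP; split; apply/allrelP => x y.
      move=> xs yp; have := allP (sub _ (allP suv _ xs)) _ yp.
      by rewrite nonoverlappingC.
    move=> xp yt; exact: (allP (sub _ (allP tuv _ yt)) _ xp).
  move: lst; rewrite /total_length big_cons !big_cat /=.
  have := total_length_partition uvp; rewrite /total_length => ->.
  lra.
(* One partition of the current interval already bounds [S] by [key]; finiteness is what allows [S]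
   to be moved to the other side. *)
have Sfin : S \is a fin_num.
  have [w uvw] : variations u v f !=set0.
    move: uv; rewrite le_eqVlt => /predU1P[->|uv]; last exact: variations_neq0.
    by rewrite variationsxx; exists 0.
  rewrite ge0_fin_numE//.
  have := key _ uvw; move: S0; case: S {key} => // r; first by rewrite ltry.
rewrite -(fineK Sfin) -addeA -EFinD.
have : (TV u v f <= (e - (fine S + total_increment f t))%:E)%E.
  apply: ge_ereal_sup => _ [w uvw <-]; rewrite lee_fin.
  by have := key _ uvw; rewrite -(fineK Sfin) -EFinD lee_fin; lra.
move=> /leeD2r - /(_ (fine S + total_increment f t)%:E).
by rewrite -EFinD subrK.
Qed.

End AbsolutelyContinuous.

(** * Densities of nondecreasing absolutely continuous functions *)

Section LebesgueStieltjesDensity.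
Context {R : realType}.
Implicit Types (a b : R) (s : seq (R * R)).

Local Notation mu := (@lebesgue_measure R).

Lemma lebesgue_stieltjes_itvoc (G : cumulative R R) (l r : R) : l <= r ->
  lebesgue_stieltjes_measure G `]l, r]%classic = (G r - G l)%:E.
Proof.
move=> lr; rewrite /lebesgue_stieltjes_measure /measure_extension /=.
by rewrite measurable_mu_extE; [exact: wlength_itv_bnd|exact: is_ocitv].
Qed.

Definition globally_ac (G : R -> R) := forall e : R, 0 < e ->
  exists2 d : R, 0 < d & forall s, all (fun p => p.1 <= p.2) s ->
    pairwise nonoverlapping s -> total_length s < d -> total_increment G s < e.

Lemma open_bounded_itv (I : set R) : open I -> is_interval I ->
  (mu I < +oo)%E -> exists2 p : R * R, p.1 <= p.2 & I = `]p.1, p.2[%classic.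
Proof.
move=> oI iI muI.
have [->|/set0P[x Ix]] := eqVneq I set0.
  by exists (0, 0) => //; rewrite set_itvoo0.
have [J IE] : exists J : interval R, I = [set` J].
  by exists (Rhull I); exact: (iffLR (is_intervalP I)).
have xJ : x \in J by move: Ix; rewrite IE.
have [Jl Jr] : J.1 <> -oo%O /\ J.2 <> +oo%O.
  move: muI xJ; rewrite IE lebesgue_measure_itv.
  case: (J) => [[? ?|[]] [? ?|[]]] //=; rewrite ?itv_boundlr ?ltry ?ltNyr ?ltNyy //=.
case: J IE xJ Jl Jr => [[c l|[]] [c' r|[]]] IE xI Jl Jr //;
  try by move: xI; rewrite in_itv /= ?andbF.
exists (l, r) => /=.
  by move: xI; rewrite in_itv /= => /andP[/lteifW h1 /lteifW]; exact: le_trans.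
by rewrite -(interior_itv_bnd l r c c') -IE; exact/esym/interior_id.
Qed.

(** An open set is a countable disjoint union of open intervals. Any finitely many of them have
    total length below [d], hence total increment below [e], and the measure of [U] is the limit of
    these finite sums. *)
Lemma open_stieltjes_le (G : cumulative R R) (d e : R) :
  (forall s, all (fun p => p.1 <= p.2) s ->
    pairwise nonoverlapping s -> total_length s < d -> total_increment G s < e) ->
  forall U : set R, open U -> (mu U < d%:E)%E ->
  (lebesgue_stieltjes_measure G U <= e%:E)%E.
Proof.
move=> Gd U oU muU.
pose I := open_disjoint_itv oU.
have oI i : open (I i) := @open_disjoint_itv_open _ _ oU i.
have mI i : measurable (I i : set R) by exact: open_measurable.
have tI : trivIset setT I := @open_disjoint_itv_trivIset _ _ oU.
have UE : U = \bigcup_i I i := @open_disjoint_itv_bigcup _ _ oU.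
have muS n : (\sum_(0 <= i < n) mu (I i) <= mu U)%E.
  rewrite UE measure_bigcup//; last by move=> i _; exact: mI.
  rewrite (eq_eseriesl (Q := xpredT)); last by move=> i; exact: in_setT.
  exact: nneseries_lim_ge.
have /choice[p pP] i : exists p : R * R, p.1 <= p.2 /\ I i = `]p.1, p.2[%classic.
  have [||p p12 Ip] := @open_bounded_itv (I i) (oI i).
  - exact: open_disjoint_itv_is_interval.
  - have := muS i.+1; rewrite big_nat_recr//= => h.
    apply: (@le_lt_trans _ _ (mu U)); last by rewrite (lt_trans muU)// ltry.
    by apply: le_trans h; rewrite leeDr// sume_ge0.
  - by exists p.
have pmu i : mu (I i) = ((p i).2 - (p i).1)%:E.
  have [p12 ->] := pP i; rewrite lebesgue_measure_itv /= lte_fin.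
  by move: p12; rewrite le_eqVlt => /predU1P[->|->//]; rewrite ltxx subrr.
have pG i : (lebesgue_stieltjes_measure G (I i) <= (G (p i).2 - G (p i).1)%:E)%E.
  have [p12 IE] := pP i; rewrite -lebesgue_stieltjes_itvoc//.
  apply: le_measure; rewrite ?inE; [exact: mI|exact: measurable_itv|].
  by rewrite IE; apply: subset_itvl; rewrite bnd_simp.
rewrite UE measure_bigcup//; last by move=> i _; exact: mI.
rewrite (eq_eseriesl (Q := xpredT)); last by move=> i; exact: in_setT.
apply: lime_le; first exact: is_cvg_nneseries.
apply: nearW => n.
(* Empty components are dropped: the degenerate pair representing one may lie inside another
   component and would then violate [nonoverlapping]. *)
pose s := [seq p i | i <- iota 0 n & (p i).1 < (p i).2].
have incr : (\sum_(0 <= i < n) lebesgue_stieltjes_measure G (I i) <=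
    (total_increment G s)%:E)%E.
  rewrite /total_increment big_map big_filter /index_iota subn0 -sumEFin [leRHS]big_mkcond.
  apply: lee_sum => i _; apply: le_trans (pG i) _.
  case: ifPn => [_|]; first by rewrite lee_fin ler_norm.
  rewrite -leNgt => h; have [h' _] := pP i.
  have -> : (p i).1 = (p i).2 by apply/eqP; rewrite eq_le h h'.
  by rewrite subrr lexx.
apply: (le_trans incr); rewrite lee_fin; apply/ltW/Gd.
- by apply/allP => q /mapP[i _ ->]; have [] := pP i.
- rewrite pairwise_map.
  have: pairwise (fun i j => i != j) [seq i <- iota 0 n | (p i).1 < (p i).2].
    by rewrite -uniq_pairwise filter_uniq// iota_uniq.
  apply: (@sub_in_pairwise _ [pred i | (p i).1 < (p i).2]); last first.
    by rewrite all_filter; apply/allP => i _ /=; apply/implyP.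
  move=> i j; rewrite !inE => pi pj ij.
  rewrite /= /nonoverlapping !leNgt -negb_and; apply/negP => /andP[h1 h2].
  move: ij => /eqP; apply.
  apply: (tI i j Logic.I Logic.I).
  have [_ Ii] := pP i; have [_ Ij] := pP j; rewrite Ii Ij.
  have m1 : Num.max (p i).1 (p j).1 < Num.min (p i).2 (p j).2.
    by rewrite gt_max !lt_min pi pj h1 h2.
  have := midf_lt m1 => -[].
  rewrite gt_max => /andP[q1 q2]; rewrite lt_min => /andP[q3 q4].
  by eexists; split; rewrite /= in_itv /=; apply/andP; split; eassumption.
- rewrite -lte_fin; apply: le_lt_trans muU; apply: le_trans (muS n).
  rewrite /total_length big_map big_filter big_mkcond /index_iota subn0 -sumEFin.
  apply: lee_sum => i _; rewrite pmu lee_fin; case: ifP => // _.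
  by rewrite subr_ge0; have [] := pP i.
Qed.

(** Outer regularity encloses a null set in an open set of length below any given [d], to which
    [open_stieltjes_le] applies. *)
Lemma stieltjes_dominates (G : cumulative R R) : globally_ac G ->
  lebesgue_stieltjes_measure G `<< mu.
Proof.
move=> Gac; apply/null_content_dominatesP => N mN N0.
apply/eqP; rewrite eq_le measure_ge0 andbT; apply/lee_addgt0Pr => e e0.
rewrite add0e; have [d d0 Gd] := Gac _ e0.
have [|U [oU NU UN]] := lebesgue_regularity_outer mN _ d0; first by rewrite N0.
have mU : measurable (U : set R) by exact: open_measurable.
apply: le_trans (open_stieltjes_le Gd oU _).
  by apply: le_measure; rewrite ?inE.
rewrite -(setDUK NU) measureU//; last 2 first.
- exact: measurableD.
- by rewrite setDE setIA setIC setIA setICl set0I.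
by rewrite [X in (X + _)%E]N0 add0e.
Qed.

(** A Stieltjes measure requires a function on the whole line, so [g] is extended by constants
    through [clip], which is nondecreasing and does not expand lengths. *)
Lemma nondecreasing_ac_density a b (g : R -> R) : a < b ->
  {in `[a, b] &, {homo g : x y / x <= y}} -> ac a b g ->
  exists2 rho : R -> R, mu.-integrable `[a, b] (EFin \o rho) &
    forall x, a <= x <= b -> g x = g a + \int[mu]_(t in `[a, x]) rho t.
Proof.
move=> ab gnd gac.
pose clip x := Num.max a (Num.min b x).
have clip_in x : clip x \in `[a, b].
  by rewrite in_itv /= /clip le_max lexx ge_max ge_min lexx (ltW ab).
have clip_le x y : x <= y -> clip x <= clip y.
  by move=> xy; rewrite /clip !maxEle !minEle; do !case: ifPn; rewrite -?ltNge; lra.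
have clip_id x : a <= x <= b -> clip x = x.
  by move=> /andP[ax xb]; rewrite /clip min_r// max_r.
have clip_sub x y : x <= y -> clip y - clip x <= y - x.
  by move=> xy; rewrite /clip !maxEle !minEle; do !case: ifPn; rewrite -?ltNge; lra.
pose G := g \o clip.
have Gnd : nondecreasing G by move=> x y xy; apply: gnd => //; exact: clip_le.
have Gac : globally_ac G.
  move=> e /gac[d d0 gd]; exists d => // s s12 sp sd.
  pose s' := [seq (clip q.1, clip q.2) | q <- s].
  have -> : total_increment G s = total_increment g s'.
    by rewrite /total_increment big_map.
  apply: gd.
    apply/andP; split.
      rewrite all_map; apply: sub_all s12 => q q12 /=.
      have := clip_in q.1; have := clip_in q.2; rewrite !in_itv /=.
      by move=> /andP[_ ->] /andP[-> _]; rewrite clip_le.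
    rewrite pairwise_map; apply: sub_pairwise sp => q r /orP[h|h].
      by rewrite /nonoverlapping /= clip_le.
    by rewrite /nonoverlapping /= orbC clip_le.
  apply: le_lt_trans sd; rewrite /total_length big_map big_seq [leRHS]big_seq.
  apply: ler_sum => q qs /=; apply: clip_sub; exact: (allP s12).
have Grc : right_continuous G.
  move=> x; apply/cvgrPdist_lt => e /Gac[d d0 Gd].
  near=> y.
  have xy : x < y by near: y; exact: nbhs_right_gt.
  have := Gd [:: (x, y)]; rewrite /total_length /total_increment !big_seq1 /= distrC.
  apply => //; first by rewrite (ltW xy).
  rewrite ltrBlDl; near: y; apply: nbhs_right_lt; by rewrite ltrDl.
pose Gc : cumulative R R := HB.pack G (isCumulative.Build R _ R G Gnd Grc).
have mab : measurable (`]a, b]%classic : set (measurableTypeR R)) by exact: measurable_itv.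
have Gab : (lebesgue_stieltjes_measure Gc `]a, b]%classic < +oo)%E.
  by rewrite lebesgue_stieltjes_itvoc ?ltry// ltW.
(* Restricting to []a, b]] gives a finite measure, as the Radon-Nikodym theorem requires. *)
pose nu : {finite_measure set (measurableTypeR R) -> \bar R} :=
  @mfrestr _ (measurableTypeR R) R _ (lebesgue_stieltjes_measure Gc) mab Gab.
have dom : nu `<< mu.
  apply/null_content_dominatesP => N mN N0; rewrite /nu /= /mfrestr /mrestr.
  have /null_content_dominatesP := @stieltjes_dominates Gc Gac; apply.
    exact: measurableI.
  apply/eqP; rewrite eq_le measure_ge0 andbT -[leRHS]N0.
  by apply: le_measure; rewrite ?inE//; exact: measurableI.
have [rho [rho0 rhof rhoi rhoE]] := radon_nikodym_sigma_finite dom.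
have rhoK : EFin \o (fine \o rho) = rho by apply/funext => x /=; rewrite fineK.
exists (fine \o rho).
  by rewrite rhoK; apply: integrableS rhoi.
move=> x /andP[ax xb].
have := rhoE `]a, x]%classic (measurable_itv _).
rewrite {1}/nu /= /mfrestr /mrestr setIidl; last first.
  by apply: subset_itvl; rewrite bnd_simp.
rewrite lebesgue_stieltjes_itvoc//= /G /= !clip_id ?ax ?xb ?lexx ?(ltW ab)//.
rewrite integral_itv_obnd_cbnd; last first.
  by apply: measurable_funTS; exact: measurable_int rhoi.
move=> h; rewrite /Rintegral (eq_integral rho) => [|t _]; last by rewrite /= fineK.
by rewrite -h /=; lra.
Unshelve. all: by end_near. Qed.

End LebesgueStieltjesDensity.

#[local] Instance ae_lebesgue_filter {R : realType} :
  Filter (almost_everywhere (@lebesgue_measure R)) := ae_filter_ringOfSetsType _.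

(** * Primitives of integrable functions *)

Section Primitives.
Context {R : realType}.
Implicit Types (a b : R) (f g h rho : R -> R).

Local Notation mu := (@lebesgue_measure R).
Local Notation TV := total_variation.

Lemma acB a b f g : ac a b f -> ac a b g -> ac a b (f \- g).
Proof.
move=> fac gac e e0; have e20 : 0 < e / 2 by rewrite divr_gt0.
have [d1 d10 fd] := fac _ e20; have [d2 d20 gd] := gac _ e20.
exists (Num.min d1 d2); first by rewrite lt_min d10.
move=> s sab; rewrite lt_min => /andP[/(fd _ sab) h1 /(gd _ sab) h2].
rewrite [e]splitr; apply: le_lt_trans (ltrD h1 h2).
rewrite /total_increment -big_split /=; apply: ler_sum => p _.
have -> : f p.2 - g p.2 - (f p.1 - g p.1) = (f p.2 - f p.1) - (g p.2 - g p.1) by ring.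
exact: ler_normB.
Qed.

(** For [e = 1], every subinterval shorter than [d] has variation at most 1; finitely many steps of
    length [d / 2] then reach [x] from [a]. *)
Lemma ac_total_variation_fin a b f : ac a b f -> forall x, a <= x <= b ->
  TV a x f \is a fin_num.
Proof.
move=> fac; have [d d0 fd] := fac _ ltr01.
have small u v : a <= u -> u <= v -> v <= b -> v - u < d -> TV u v f \is a fin_num.
  move=> au uv vb uvd.
  rewrite ge0_fin_numE ?total_variation_ge0//.
  have := ac_sum_total_variation fd (s := [:: (u, v)]) (t := [::]).
  rewrite /subintervals /total_length /total_increment !big_seq1 big_nil /=.
  by rewrite au uv vb adde0 => /(_ isT uvd) /le_lt_trans; apply; rewrite ltry.
have d20 : 0 < d / 2 by rewrite divr_gt0.
have step (k : nat) : forall x, a <= x <= b -> x - a <= k%:R * (d / 2) ->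
    TV a x f \is a fin_num.
  elim: k => [|k IH] x /andP[ax xb] xk.
    rewrite mul0r in xk; have -> : x = a by lra.
    by rewrite total_variationxx.
  have [xd|dx] := ltP (x - a) (d / 2); first by apply: small => //; lra.
  have ay : a <= x - d / 2 by lra.
  have yx : x - d / 2 <= x by lra.
  rewrite (total_variationD f ay yx) fin_numD; apply/andP; split.
    apply: IH; first by rewrite ay (le_trans yx xb).
    by rewrite mulrSr mulrDl mul1r in xk; lra.
  by apply: small => //; lra.
move=> x axb; apply: (step (Num.bound ((x - a) / (d / 2)))) => //.
rewrite -ler_pdivrMr//; apply/ltW/archi_boundP.
by rewrite divr_ge0 ?(ltW d20)// subr_ge0; case/andP: axb.
Qed.

(** Absolute continuity in integrated form. Naming the density lets the calculus rules below produce
    densities explicitly, and values of [f] outside [[a, b]] stay irrelevant. *)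
Definition primitive a b f rho := mu.-integrable `[a, b] (EFin \o rho) /\
  forall x, a <= x <= b -> f x = f a + \int[mu]_(t in `[a, x]) rho t.

Lemma integrable_sub_itv a b x rho : x <= b -> mu.-integrable `[a, b] (EFin \o rho) ->
  mu.-integrable `[a, x] (EFin \o rho).
Proof.
move=> xb; apply: integrableS => //.
by apply: subset_itvl; rewrite bnd_simp.
Qed.

Lemma primitiveZD a b c f g rho sigma : primitive a b f rho ->
  primitive a b g sigma ->
  primitive a b (fun x => c * f x + g x) (fun x => c * rho x + sigma x).
Proof.
move=> [irho fE] [isigma gE]; split.
  have : mu.-integrable `[a, b] (fun x => c%:E * (EFin \o rho) x + (EFin \o sigma) x)%E.
    by apply: integrableD => //; exact: integrableZl.
  by apply: eq_integrable.
move=> x /[dup] axb /andP[ax xb].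
have irho' := integrable_sub_itv xb irho; have isigma' := integrable_sub_itv xb isigma.
have irhoc : mu.-integrable `[a, x] (EFin \o (fun t => c * rho t)).
  have : mu.-integrable `[a, x] (fun t => c%:E * (EFin \o rho) t)%E by exact: integrableZl.
  exact: eq_integrable.
rewrite RintegralD// RintegralZl// fE// gE//; ring.
Qed.

(** Jordan decomposition: with [g] the variation of [f] from [a], both [g] and [g - f] are
    nondecreasing and absolutely continuous, and [f] is their difference. *)
Lemma ac_density a b f : a < b -> ac a b f -> exists rho, primitive a b f rho.
Proof.
move=> ab fac; pose g x := fine (TV a x f).
have gB x y : a <= x -> x <= y -> y <= b -> (g y - g x)%:E = TV x y f.
  move=> ax xy yb; have ay := le_trans ax xy.
  have := total_variationD f ax xy.
  have fx : TV a x f \is a fin_num.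
    by apply: ac_total_variation_fin fac _ _; rewrite ax (le_trans xy yb).
  have fy : TV a y f \is a fin_num.
    by apply: ac_total_variation_fin fac _ _; rewrite ay yb.
  rewrite EFinB /g !fineK// => ->.
  by rewrite addeAC subee// add0e.
have inP x : x \in `[a, b] -> a <= x /\ x <= b by rewrite in_itv => /andP[].
have gnd : {in `[a, b] &, {homo g : x y / x <= y}}.
  move=> x y /inP[ax xb] /inP[ay yb] xy.
  by rewrite -subr_ge0 -lee_fin gB// total_variation_ge0.
have gac : ac a b g.
  move=> e e0; have e20 : 0 < e / 2 by rewrite divr_gt0.
  have [d d0 fd] := fac _ e20; exists d => // s sab sd.
  have := ac_sum_total_variation fd (s := s) (t := [::]).
  rewrite cats0 => /(_ sab sd); rewrite /total_increment big_nil adde0 => h.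
  suff : ((\sum_(p <- s) `|g p.2 - g p.1|)%:E <= (e / 2)%:E)%E by rewrite lee_fin; lra.
  apply: le_trans h; rewrite -sumEFin big_seq [leRHS]big_seq; apply: lee_sum => p ps.
  have /andP[/allP/(_ _ ps)/and3P[h1 h2 h3] _] := sab.
  by rewrite -gB// lee_fin ger0_norm// -lee_fin gB// total_variation_ge0.
have [rho irho gE] := nondecreasing_ac_density ab gnd gac.
have [|sigma isigma hE] := nondecreasing_ac_density ab _ (acB gac fac).
  move=> x y /inP[ax xb] /inP[ay yb] xy /=.
  suff : f y - f x <= g y - g x by lra.
  rewrite -lee_fin gB//.
  have := total_variation_ge f xy; rewrite -gB// !lee_fin => h.
  by have := ler_norm (f y - f x); lra.
exists (fun x => - 1 * sigma x + rho x).
have [iden fE] := @primitiveZD a b (- 1) _ _ _ _ (conj isigma hE) (conj irho gE).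
split=> // x axb; have := fE x axb => /=; lra.
Qed.

Lemma integrable_patch (D : set R) rho : measurable D -> mu.-integrable D (EFin \o rho) ->
  mu.-integrable setT (EFin \o (rho \_ D)).
Proof.
move=> mD /integrable_mkcond => /(_ mD); apply: eq_integrable => // x _ /=.
by rewrite /patch; case: ifP.
Qed.

Lemma primitive_increment a b f rho u v : primitive a b f rho ->
  a <= u -> u <= v -> v <= b ->
  f v - f u = \int[mu]_(t in `]u, v]) rho t.
Proof.
move=> [irho fE] au uv vb.
rewrite (fE v) ?(le_trans au uv)// (fE u) ?au ?(le_trans uv vb)//.
rewrite -(@Rintegral_itvB _ rho (BLeft a) (BRight v) u) ?bnd_simp//; first by ring.
exact: integrable_sub_itv irho.
Qed.

(** Absolute continuity of the integral of [|rho|], applied to the union of the intervals. The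
    families are indexed by ['I_N] to match [abs_continuous]. *)
Lemma primitive_small_increments a b f rho : primitive a b f rho ->
  forall e, 0 < e -> exists2 d : R, 0 < d &
    forall (N : nat) (u v : 'I_N -> R),
      (forall j, [/\ a <= u j, u j <= v j & v j <= b]) ->
      trivIset [set: 'I_N] (fun j => [set` `]u j, v j[]) ->
      \sum_j (v j - u j) < d -> \sum_j `|f (v j) - f (u j)| < e.
Proof.
move=> fprim e e0; have [irho fE] := fprim.
pose r := rho \_ `[a, b].
have ir : mu.-integrable setT (EFin \o r) by exact: integrable_patch.
have [d [d0 rd]] := integral_normr_continuous ir e0.
exists d => // N u v uv tI sd.
pose D := \big[setU/set0]_(j <- enum 'I_N) `]u j, v j[%classic.
have mD : measurable (D : set R) by apply: bigsetU_measurable.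
have tI' : trivIset [set` enum 'I_N] (fun j => [set` `]u j, v j[]).
  by apply: sub_trivIset tI.
have muD : (mu D < d%:E)%E.
  have -> : mu D = (\int[mu]_(x in D) (cst 1 x))%E by rewrite integral_cst ?mul1e.
  rewrite ge0_integral_bigsetU// ?enum_uniq//.
  apply: le_lt_trans (_ : ((\sum_j (v j - u j))%:E < _)%E); last by rewrite lte_fin.
  rewrite -sumEFin big_enum /=; apply: lee_sum => j _.
  rewrite integral_cst//= mul1e lebesgue_measure_itv /= lte_fin; case: ifP => //.
  by rewrite lee_fin subr_ge0; have [] := uv j.
have iabs : mu.-integrable setT (EFin \o (fun x => `|r x|)) by exact: integrable_norm.
apply: le_lt_trans (rd _ mD muD).
have -> : \int[mu]_(x in D) `|r x| = \sum_j \int[mu]_(x in `]u j, v j[) `|r x|.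
  rewrite /Rintegral integral_bigsetU_EFin ?enum_uniq//; last first.
    by apply: measurable_funTS; exact: measurable_int iabs.
  rewrite big_enum /= -[RHS]/(fine (_%:E)) -sumEFin; congr fine; apply: eq_bigr => j _.
  by rewrite fineK//; apply: integrable_fin_num => //; exact: integrableS iabs.
apply: ler_sum => j _; have [au ujv vb] := uv j.
rewrite (primitive_increment fprim)//.
rewrite -Rintegral_itv_bndo_bndc; last first.
  apply: integrableS irho => //; apply: subset_itv; rewrite bnd_simp//.
apply: le_trans (le_normr_Rintegral _ _) _ => //.
  apply: integrableS irho => //; apply: subset_itv; rewrite bnd_simp//.
rewrite le_eqVlt; apply/orP; left; apply/eqP.
apply: eq_Rintegral => x; rewrite inE /= in_itv /= => /andP[ux xv].
rewrite /r patchE mem_set//= in_itv /=.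
by rewrite (le_trans au (ltW ux)) (le_trans (ltW xv) vb).
Qed.

Lemma primitive_abs_continuous a b f g rho sigma :
  primitive a b f rho -> primitive a b g sigma ->
  abs_continuous a b (fun x => f x +i* g x).
Proof.
move=> /primitive_small_increments hf /primitive_small_increments hg e e0.
have e20 : 0 < e / 2 by rewrite divr_gt0.
have [d1 d10 fd] := hf _ e20; have [d2 d20 gd] := hg _ e20.
exists (Num.min d1 d2); first by rewrite lt_min d10.
move=> N u v uv tI; rewrite lt_min => /andP[/(fd _ _ _ uv tI) h1 /(gd _ _ _ uv tI) h2].
rewrite [e]splitr.
apply: (@le_lt_trans _ _ ((\sum_j `|f (v j) - f (u j)| + \sum_j `|g (v j) - g (u j)|)%:C)).
  2: by rewrite ltcR ltrD.
rewrite -big_split /= rmorph_sum /=; apply: ler_sum => j _.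
have -> : (f (v j) +i* g (v j)) - (f (u j) +i* g (u j)) =
   (f (v j) - f (u j))%:C + 'i * (g (v j) - g (u j))%:C.
  by simpc.
rewrite (le_trans (ler_normD _ _))// normrM (_ : `|'i| = 1) ?mul1r.
  2: by rewrite normc_def /= expr0n expr1n add0r sqrtr1.
rewrite !normc_def /= expr0n /= !addr0 !sqrtr_sqr.
by rewrite -rmorphD.
Qed.

Lemma primitive_ac a b f rho : primitive a b f rho -> ac a b f.
Proof.
move=> fp; have := primitive_abs_continuous fp fp.
move=> /(@abs_continuous_ac _ _ _ _ (@complex.Re R)); apply.
by move=> z w; rewrite -raddfB /=; exact: normc_ge_Re.
Qed.

Lemma ac_continuous a b f : ac a b f -> {within `[a, b], continuous f}.
Proof.
move=> fac; apply/subspace_continuousP => x; rewrite /= in_itv /= => /andP[ax xb].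
apply/cvgrPdist_lt => e /fac[d d0 fd]; rewrite near_withinE.
near=> y; rewrite /= in_itv /= => /andP[ay yb].
have xyd : `|x - y| < d by near: y; exact: cvgr_dist_lt.
have [xy|/ltW yx] := leP x y.
  have := fd [:: (x, y)]; rewrite /subintervals /total_length /total_increment !big_seq1 /= distrC.
  by apply; rewrite ?ax ?xy ?yb// -(ger0_norm (_ : 0 <= y - x)) ?subr_ge0// distrC.
have := fd [:: (y, x)]; rewrite /subintervals /total_length /total_increment !big_seq1 /=.
by apply; rewrite ?ay ?yx ?xb// -(ger0_norm (_ : 0 <= x - y)) ?subr_ge0.
Unshelve. all: by end_near. Qed.

Lemma continuous_bounded a b f : {within `[a, b], continuous f} ->
  exists M : R, forall x, `[a, b]%classic x -> `|f x| <= M.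
Proof.
move=> fc; have /compact_bounded [M [_ hM]] :=
  continuous_compact fc (@segment_compact _ a b).
exists (M + 1) => x abx; apply: hM; first by rewrite ltrDl.
by exists x.
Qed.

(** The two endpoints form a null set. They must be discarded because a derivative at an endpoint
    depends on values outside [[a, b]]. *)
Lemma ae_itv_oo_cc a b (P : R -> Prop) :
  {ae mu, forall x, `]a, b[%classic x -> P x} ->
  {ae mu, forall x, `[a, b]%classic x -> P x}.
Proof.
move=> h.
have neq c : {ae mu, forall x, x != c}.
  exists [set c]; split; rewrite ?lebesgue_measure_set1//.
  by move=> x /= /negP; rewrite negbK => /eqP.
apply: filterS3 h (neq a) (neq b) => x + xa xb; rewrite /= !in_itv /= => h /andP[ax bx].
by apply: h; rewrite !lt_neqAle eq_sym xa ax xb bx.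
Qed.

(** Lebesgue's differentiation theorem, available as [FTC1] for [rho] extended by zero; near an
    interior point [f] coincides with [f a + F], which carries the derivative over. *)
Lemma primitive_derivable a b f rho : a < b -> primitive a b f rho ->
  {ae mu, forall x, `[a, b]%classic x -> is_derive x 1 f (rho x)}.
Proof.
move=> ab [irho fE]; apply: ae_itv_oo_cc.
pose r := rho \_ `[a, b].
have ir : mu.-integrable setT (EFin \o r) by exact: integrable_patch.
have locr : locally_integrable setT r.
  exact: integrable_locally.
have iry y : mu.-integrable [set` Interval (BLeft a) (BRight y)] (EFin \o r).
  by apply: integrableS ir.
have := FTC1 iry locr; apply: filterS => x /= H; rewrite in_itv /= => /andP[ax xb].
have [//|dF F'] := H.
have -> : rho x = r x by rewrite /r patchE mem_set//= in_itv /= !ltW.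
pose F x := \int[mu]_(t in `[a, x]) r t.
have dF' : is_derive x 1 F (r x) by rewrite -F' derive1E; exact: DeriveDef.
have : is_derive x 1 (cst (f a) \+ F) (0 + r x) by exact: is_deriveD.
rewrite add0r; apply: near_eq_is_derive.
near=> y.
have ay : a < y by near: y; exact: lt_nbhsr.
have yb : y < b by near: y; exact: lt_nbhsl.
rewrite /= (fE y) ?(ltW ay) ?(ltW yb)//; congr (f a + _).
apply: eq_Rintegral => t; rewrite inE /= in_itv /= => /andP[h1 h2].
by rewrite /r patchE mem_set//= in_itv /= h1 (le_trans h2 (ltW yb)).
Unshelve. all: by end_near. Qed.

Lemma integrable_bounded_mul (D : set R) f g (M : R) : measurable D ->
  measurable_fun D f -> (forall x, D x -> `|f x| <= M) ->
  mu.-integrable D (EFin \o g) -> mu.-integrable D (EFin \o (fun x => f x * g x)).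
Proof.
move=> mD mf fM ig.
have iMg : mu.-integrable D (fun x => M%:E * (EFin \o g) x)%E by exact: integrableZl.
apply: le_integrable iMg => //.
  apply/measurable_EFinP/measurable_funM => //.
  by apply/measurable_EFinP; exact: measurable_int ig.
move=> x Dx /=; rewrite lee_fin !normrM ler_wpM2r//.
by rewrite (le_trans (fM _ Dx))// ler_norm.
Qed.

Lemma continuous_integrable_mul a b f g : {within `[a, b], continuous f} ->
  mu.-integrable `[a, b] (EFin \o g) ->
  mu.-integrable `[a, b] (EFin \o (fun x => f x * g x)).
Proof.
move=> fc; have [M fM] := continuous_bounded fc.
apply: integrable_bounded_mul fM => //.
exact: subspace_continuous_measurable_fun.
Qed.

Lemma acM a b f g : ac a b f -> ac a b g -> ac a b (f \* g).
Proof.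
move=> fac gac e e0.
have [M fM] := continuous_bounded (ac_continuous fac).
have [M' gM] := continuous_bounded (ac_continuous gac).
pose K := `|M| + `|M'| + 1.
have K0 : 0 < K by rewrite ltr_wpDl// addr_ge0.
have e20 : 0 < e / 2 / K by rewrite !divr_gt0.
have [d1 d10 fd] := fac _ e20; have [d2 d20 gd] := gac _ e20.
exists (Num.min d1 d2); first by rewrite lt_min d10.
move=> s sab; rewrite lt_min => /andP[/(fd _ sab) h1 /(gd _ sab) h2].
have : K * (total_increment f s + total_increment g s) < e.
  by rewrite mulrC -ltr_pdivlMr// [e]splitr mulrDl ltrD.
apply: le_lt_trans.
rewrite /total_increment -big_split mulr_sumr /= big_seq [leRHS]big_seq.
apply: ler_sum => p ps.
have /andP[/allP/(_ _ ps)/and3P[q1 q2 q3] _] := sab.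
have -> : f p.2 * g p.2 - f p.1 * g p.1 =
  (f p.2 - f p.1) * g p.2 + f p.1 * (g p.2 - g p.1) by ring.
rewrite (le_trans (ler_normD _ _))// !normrM mulrDr lerD//.
  rewrite mulrC ler_wpM2r//; apply: le_trans (gM _ _) _.
    by rewrite /= in_itv /= q3 (le_trans q1 q2).
  by have := ler_norm M'; have := normr_ge0 M; rewrite /K; lra.
rewrite ler_wpM2r//; apply: le_trans (fM _ _) _.
  by rewrite /= in_itv /= q1 (le_trans q2 q3).
by have := ler_norm M; have := normr_ge0 M'; rewrite /K; lra.
Qed.

(** Two almost everywhere derivatives of [f] agree almost everywhere, so once a density exists, any
    integrable almost everywhere derivative can replace it. This gives the product rule below: a
    product of absolutely continuous functions has some density, and the pointwise Leibniz rule
    identifies it. *)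
Lemma primitive_eq_density a b f rho sigma : a < b -> primitive a b f rho ->
  mu.-integrable `[a, b] (EFin \o sigma) ->
  {ae mu, forall x, `[a, b]%classic x -> is_derive x 1 f (sigma x)} ->
  primitive a b f sigma.
Proof.
move=> ab fp isigma fsigma; have fder := primitive_derivable ab fp.
have eq : ae_eq mu `[a, b]%classic sigma rho.
  apply: filterS2 fsigma fder => x h1 h2 abx.
  by have /@derive_val <- := h1 abx; have /@derive_val <- := h2 abx.
case: fp => irho fE; split=> // x /andP[ax xb]; rewrite fE ?ax//; congr (_ + _).
have sub : `[a, x]%classic `<=` `[a, b]%classic.
  by apply: subset_itvl; rewrite bnd_simp.
rewrite /Rintegral; congr fine; apply: ae_eq_integral => //.
- by apply: measurable_int (integrable_sub_itv xb irho).
- by apply: measurable_int (integrable_sub_itv xb isigma).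
- apply: filterS eq => t h /sub abt /=; congr EFin; symmetry; exact: h.
Qed.

Lemma primitiveM a b f g rho sigma : a < b -> primitive a b f rho ->
  primitive a b g sigma ->
  primitive a b (fun x => f x * g x) (fun x => rho x * g x + f x * sigma x).
Proof.
move=> ab fp gp.
have [tau fgp] := ac_density ab (acM (primitive_ac fp) (primitive_ac gp)).
apply: (primitive_eq_density ab fgp).
  have fc := ac_continuous (primitive_ac fp).
  have gc := ac_continuous (primitive_ac gp).
  have i1 := continuous_integrable_mul gc fp.1.
  have i2 := continuous_integrable_mul fc gp.1.
  have : mu.-integrable `[a, b] (fun x => (g x * rho x)%:E + (f x * sigma x)%:E)%E by exact: integrableD.
  by apply: eq_integrable => // x _ /=; rewrite mulrC -EFinD.
apply: filterS2 (primitive_derivable ab fp) (primitive_derivable ab gp).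
move=> x h1 h2 abx; have {}h1 := h1 abx; have {}h2 := h2 abx.
have -> : rho x * g x + f x * sigma x =
    f x *: (sigma x : R^o) + g x *: (rho x : R^o) by rewrite /GRing.scale /=; ring.
exact: is_deriveM.
Qed.

End Primitives.

(** * Linear systems with integrable coefficients *)

Section LinearODE.
Context {R : realType}.
Implicit Types (a b : R) (f g h rho : R -> R).

Local Notation mu := (@lebesgue_measure R).

Lemma antiderivative a b (c : R) rho : mu.-integrable `[a, b] (EFin \o rho) ->
  primitive a b (fun x => c + \int[mu]_(t in `[a, x]) rho t) rho.
Proof. by move=> irho; split=> // x _; rewrite set_itv1 Rintegral_set1 addr0. Qed.

Lemma antiderivative_start a (c : R) rho :
  c + \int[mu]_(t in `[a, a]) rho t = c.
Proof. by rewrite set_itv1 Rintegral_set1 addr0. Qed.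

Lemma eq_primitive a b f g rho sigma : {in `[a, b], f =1 g} ->
  {in `[a, b], rho =1 sigma} -> primitive a b f rho -> primitive a b g sigma.
Proof.
move=> fg rs [irho fE]; split.
  apply: eq_integrable irho => // x; rewrite inE /= => xab; congr EFin; exact: rs.
move=> x /andP[ax xb]; rewrite -!fg ?in_itv /= ?ax ?lexx ?(le_trans ax xb)//.
rewrite fE ?ax//; congr (_ + _); apply: eq_Rintegral => t; rewrite inE /= in_itv /=.
by move=> /andP[h1 h2]; apply: rs; rewrite in_itv /= h1 (le_trans h2 xb).
Qed.

Lemma primitive0 a b : primitive a b (fun=> 0) (fun=> 0 : R).
Proof.
have := @antiderivative a b 0 (fun=> 0).
have i0 : mu.-integrable `[a, b] (EFin \o (fun=> 0 : R)) by exact: integrable0.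
move=> /(_ i0); apply: eq_primitive => // x _.
rewrite add0r /Rintegral integral0//.
Qed.

Lemma primitive_sum a b (I : Type) (s : seq I) (c : I -> R) (f rho : I -> R -> R) :
  (forall i, primitive a b (f i) (rho i)) ->
  primitive a b (fun x => \sum_(i <- s) c i * f i x) (fun x => \sum_(i <- s) c i * rho i x).
Proof.
move=> fp; elim: s => [|i s IH].
  apply: eq_primitive (primitive0 a b) => x _; by rewrite big_nil.
by apply: eq_primitive (primitiveZD (c i) (fp i) IH) => x _; rewrite big_cons.
Qed.

Lemma primitive_sum1 a b (I : Type) (s : seq I) (f rho : I -> R -> R) :
  (forall i, primitive a b (f i) (rho i)) ->
  primitive a b (fun x => \sum_(i <- s) f i x) (fun x => \sum_(i <- s) rho i x).
Proof.
move=> /(primitive_sum s (fun=> 1)); apply: eq_primitive => x _;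
  by apply: eq_bigr => i _; rewrite mul1r.
Qed.

Lemma primitiveD a b f g rho sigma : primitive a b f rho -> primitive a b g sigma ->
  primitive a b (fun x => f x + g x) (fun x => rho x + sigma x).
Proof.
by move=> fp /(primitiveZD 1 fp); apply: eq_primitive => x _; rewrite mul1r.
Qed.

Lemma primitive_itv a b f rho : a <= b -> primitive a b f rho ->
  \int[mu]_(t in `[a, b]) rho t = f b - f a.
Proof. by move=> ab [_ /(_ b)]; rewrite ab lexx => ->//; ring. Qed.

Lemma integrable_sum_mul a b (I : Type) (s : seq I) (f g : I -> R -> R) :
  (forall i, mu.-integrable `[a, b] (EFin \o (f i))) ->
  (forall i, {within `[a, b], continuous (g i)}) ->
  mu.-integrable `[a, b] (EFin \o (fun x => \sum_(i <- s) f i x * g i x)).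
Proof.
move=> fi gc.
have fgp i : primitive a b (fun x => 0 + \int[mu]_(t in `[a, x]) (f i t * g i t))
    (fun t => f i t * g i t).
  apply: antiderivative; have := continuous_integrable_mul (gc i) (fi i).
  by apply: eq_integrable => // x _ /=; rewrite mulrC.
by have [] := primitive_sum1 s fgp.
Qed.

Lemma primitive_continuous a b f rho : primitive a b f rho -> {within `[a, b], continuous f}.
Proof. by move=> /primitive_ac /ac_continuous. Qed.

Lemma primitive_le a b f rho h beta : primitive a b f rho -> primitive a b h beta ->
  (forall x, a <= x <= b -> `|rho x| <= beta x) ->
  forall x, a <= x <= b -> `|f x - f a| <= h x - h a.
Proof.
move=> [irho fE] [ibeta hE] rb x /[dup] axb /andP[ax xb].
rewrite fE// hE//.
have -> (c d : R) : c + d - c = d by ring.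
have -> (c d : R) : c + d - c = d by ring.
apply: le_trans (le_normr_Rintegral _ _) _ => //; first exact: integrable_sub_itv irho.
apply: le_Rintegral => //.
- have := integrable_norm (integrable_sub_itv xb irho).
  by apply: eq_integrable.
- exact: integrable_sub_itv ibeta.
- by move=> t; rewrite /= in_itv /= => /andP[h1 h2]; rewrite rb// h1 (le_trans h2).
Qed.

Lemma primitiveX a b f rho (k : nat) : a < b -> primitive a b f rho ->
  primitive a b (fun x => f x ^+ k.+1) (fun x => k.+1%:R * f x ^+ k * rho x).
Proof.
move=> ab fp; elim: k => [|k IH].
  by apply: eq_primitive fp => x _; rewrite ?expr1 ?expr0 ?mul1r ?mulr1.
apply: eq_primitive (primitiveM ab fp IH) => x _; first by rewrite -exprS.
rewrite [in RHS]mulrSr [f x ^+ k.+1]exprS; ring.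
Qed.

Lemma cvg_bigsum (I : Type) (s : seq I) (u : I -> nat -> R) (l : I -> R) :
  (forall i, u i n @[n --> \oo] --> l i) ->
  (\sum_(i <- s) u i n) @[n --> \oo] --> \sum_(i <- s) l i.
Proof.
move=> ul; elim: s => [|i s IH].
  rewrite big_nil; under eq_fun do rewrite big_nil.
  exact: cvg_cst.
by rewrite big_cons; under eq_fun do rewrite big_cons; exact: cvgD (ul i) IH.
Qed.

(** * Picard iteration for an integrable coefficient matrix *)

Section Picard.
Variables (a b : R) (m : nat) (B : R -> 'M[R]_m) (F : 'I_m -> R -> R) (c : 'I_m -> R).
Hypothesis ab : a < b.
Hypothesis iB : forall i j, mu.-integrable `[a, b] (EFin \o (fun x => B x i j)).
Hypothesis iF : forall i, mu.-integrable `[a, b] (EFin \o F i).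

Let u0 i x : R := c i + \int[mu]_(t in `[a, x]) F i t.

Let step (u : 'I_m -> R -> R) i x : R :=
  \int[mu]_(t in `[a, x]) \sum_j B t i j * u j t.

(** These are the terms of the Neumann series; the Picard approximations are their partial sums
    [S]. *)
Let u k := iter k step u0.

(** One integrable majorant for all row sums. Its primitive [h] plays the role that a constant times
    [x - a] has for a bounded matrix. *)
Let beta x : R := \sum_i \sum_j `|B x i j|.

Let h x : R := \int[mu]_(t in `[a, x]) beta t.

Let u0_primitive i : primitive a b (u0 i) (F i).
Proof. exact: antiderivative. Qed.

Let u_step k i :
  primitive a b (u k.+1 i) (fun x => \sum_j B x i j * u k j x) /\ u k.+1 i a = 0.
Proof.
have uc : forall j, {within `[a, b], continuous (u k j)}.
  elim: k => [|k IH] j; first exact: primitive_continuous (u0_primitive j).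
  have iBu := integrable_sum_mul (index_enum 'I_m) (iB j) IH.
  apply: primitive_continuous (eq_primitive _ _ (antiderivative 0 iBu)) => x _ //.
  by rewrite add0r.
have iBu := integrable_sum_mul (index_enum 'I_m) (iB i) uc.
split; last by rewrite /u iterS /step set_itv1 Rintegral_set1.
by apply: eq_primitive (antiderivative 0 iBu) => // x _; rewrite add0r.
Qed.

Let u_continuous k i : {within `[a, b], continuous (u k i)}.
Proof.
case: k => [|k]; first exact: primitive_continuous (u0_primitive i).
exact: primitive_continuous (u_step k i).1.
Qed.

Let beta_ge x i : \sum_j `|B x i j| <= beta x.
Proof.
rewrite /beta [leRHS](bigD1 i)//= lerDl; apply: sumr_ge0 => k _; exact: sumr_ge0.
Qed.

Let beta0 x : 0 <= beta x.
Proof. by apply: sumr_ge0 => i _; exact: sumr_ge0. Qed.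

Let h_primitive : primitive a b h beta.
Proof.
have ib i j : mu.-integrable `[a, b] (EFin \o (fun x => `|B x i j|)).
  by have := integrable_norm (iB i j); apply: eq_integrable.
have hb : primitive a b
    (fun x => \sum_i \sum_j (0 + \int[mu]_(t in `[a, x]) `|B t i j|)) beta.
  apply: primitive_sum1 => i; apply: primitive_sum1 => j; exact: antiderivative.
by apply: eq_primitive (antiderivative 0 hb.1) => // x _; rewrite add0r.
Qed.

Let h_ge0 x : 0 <= h x.
Proof. exact: Rintegral_ge0. Qed.

Let h_start : h a = 0.
Proof. by rewrite /h set_itv1 Rintegral_set1. Qed.

Let h_le x : a <= x <= b -> h x <= h b.
Proof.
move=> /andP[ax xb]; rewrite -subr_ge0 (primitive_increment h_primitive)//.
exact: Rintegral_ge0.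
Qed.

(** Since [beta] is the density of [h], integrating [beta * h ^+ k / k!] gives [h ^+ k.+1 / k.+1!];
    the constant [C] only has to bound the terms of index 0. *)
Let u_bound : exists2 C : R, 0 <= C & forall k i x, a <= x <= b ->
  `|u k i x| <= C * (h x ^+ k / k`!%:R).
Proof.
have /choice[M MP] : forall i, exists M, forall x, `[a, b]%classic x -> `|u0 i x| <= M.
  by move=> i; apply: continuous_bounded; exact: u_continuous 0%N i.
exists (\sum_i `|M i|); first exact: sumr_ge0.
set C := \sum_i _; have C0 : 0 <= C by exact: sumr_ge0.
elim=> [|k IH] i x axb.
  rewrite expr0 fact0 divr1 mulr1; apply: le_trans (MP i x _) _.
    by rewrite /= in_itv.
  by rewrite (le_trans (ler_norm _))// /C (bigD1 i)//= lerDl sumr_ge0.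
have [up ua] := u_step k i.
have hp := primitiveX k ab h_primitive.
have kfact : k.+1`!%:R != 0 :> R by rewrite pnatr_eq0 -lt0n fact_gt0.
have kfact' : k`!%:R != 0 :> R by rewrite pnatr_eq0 -lt0n fact_gt0.
(* The added zero primitive only serves to obtain a scalar multiple from [primitiveZD]. *)
have hp' := primitiveZD (C / k.+1`!%:R) hp (primitive0 a b).
have := primitive_le up hp' _ axb.
rewrite ua subr0 h_start expr0n /= mulr0 !addr0 subr0 => H.
have -> : C * (h x ^+ k.+1 / k.+1`!%:R) = C / k.+1`!%:R * h x ^+ k.+1 by ring.
apply: H => {x axb} x axb.
have -> : C / (k.+1)`!%:R * (k.+1%:R * h x ^+ k * beta x) + 0 =
    beta x * (C * (h x ^+ k / k`!%:R)).
  have kS : k.+1%:R != 0 :> R by rewrite pnatr_eq0.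
  rewrite factS natrM in kfact *; field.
  by rewrite kfact' nat1r kS.
apply: le_trans (ler_norm_sum _ _ _) _.
apply: le_trans (_ : \sum_j `|B x i j| * (C * (h x ^+ k / k`!%:R)) <= _).
  by apply: ler_sum => j _; rewrite normrM ler_wpM2l// IH.
by rewrite -mulr_suml ler_wpM2r// !mulr_ge0// ?exprn_ge0// invr_ge0.
Qed.

Let S N i x : R := \sum_(0 <= k < N.+1) u k i x.

Let S_continuous N i : {within `[a, b], continuous (S N i)}.
Proof.
rewrite /S; elim: N => [|N IH].
  rewrite (_ : (fun x => _) = u 0%N i); first exact: u_continuous.
  by apply/funext => x; rewrite big_nat1.
rewrite (_ : (fun x => _) = (fun x => \sum_(0 <= k < N.+1) u k i x + u N.+1 i x)).
  by move=> x; apply: cvgD; [exact: IH|exact: u_continuous].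
by apply/funext => x; rewrite big_nat_recr.
Qed.

Let S_primitive N i : primitive a b (S N.+1 i) (fun x => F i x + \sum_j B x i j * S N j x).
Proof.
elim: N => [|N IH].
  apply: eq_primitive (primitiveD (u0_primitive i) (u_step 0 i).1) => x _.
    by rewrite /S big_nat_recr//= big_nat1.
  by congr (_ + _); apply: eq_bigr => j _; rewrite /S big_nat1.
apply: eq_primitive (primitiveD IH (u_step N.+1 i).1) => x _.
  by rewrite /S [RHS]big_nat_recr.
rewrite -addrA -big_split /=; congr (_ + _); apply: eq_bigr => j _.
by rewrite -mulrDr /S [in RHS]big_nat_recr.
Qed.

Let S_start N i : S N.+1 i a = c i.
Proof.
rewrite /S big_nat_recl// big1 ?addr0 => [|k _]; last by have [] := u_step k i.
exact: antiderivative_start.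
Qed.

Let S_cvg i x : a <= x <= b -> cvgn (fun N => S N i x).
Proof.
move=> axb; have [C C0 uC] := u_bound.
have : cvgn (series (fun k => u k i x)).
  apply: normed_cvg; apply: (@series_le_cvg _ _ (fun k => C * exp_coeff (h x) k)) => //.
  - by move=> k; exact: normr_ge0.
  - by move=> k; rewrite mulr_ge0 ?exp_coeff_ge0.
  - by move=> k; exact: uC.
  - by apply: is_cvg_seriesZ; exact: is_cvg_series_exp_coeff.
move=> /cvg_ex[l ul]; apply/cvg_ex; exists l.
by move: ul; rewrite -cvg_shiftS.
Qed.

Let S_bound : exists M : R, forall N i x, a <= x <= b -> `|S N i x| <= M.
Proof.
have [C C0 uC] := u_bound; exists (C * expR (h b)) => N i x axb.
apply: le_trans (ler_norm_sum _ _ _) _.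
apply: le_trans (_ : C * series (exp_coeff (h x)) N.+1 <= _).
  by rewrite /series /= mulr_sumr; apply: ler_sum => k _; exact: uC.
rewrite ler_wpM2l//; apply: le_trans (_ : expR (h x) <= _).
  apply: nondecreasing_cvgn_le; last exact: is_cvg_series_exp_coeff.
  by apply: nondecreasing_series => k _ _; exact: exp_coeff_ge0.
by rewrite ler_expR h_le.
Qed.

(** The integral equation for the partial sums passes to the limit by dominated convergence with
    majorant [|F i| + M * beta], so pointwise convergence and a uniform bound suffice; the limit is
    measurable as a pointwise limit of continuous functions. *)
Lemma linear_ode : exists Y : 'I_m -> R -> R, forall i, Y i a = c i /\
  primitive a b (Y i) (fun x => \sum_j B x i j * Y j x + F i x).
Proof.
pose Y i x : R := limn (fun N => S N i x); exists Y.
have SY i x : a <= x <= b -> S N i x @[N --> \oo] --> Y i x.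
  by move=> /S_cvg - /(_ i).
have [M SM] := S_bound.
have YM i x : a <= x <= b -> `|Y i x| <= M.
  move=> axb; have nc : `|S N i x| @[N --> \oo] --> `|Y i x|.
    by apply: cvg_norm; exact: SY.
  rewrite -(cvg_lim _ nc)//; apply: limr_le; first by apply/cvg_ex; eexists; exact: nc.
  by apply: nearW => N; exact: SM.
have mY i : measurable_fun `[a, b] (Y i).
  apply: (@measurable_fun_cvg _ _ _ _ (fun N => S N i)).
    move=> N; apply: subspace_continuous_measurable_fun => //; exact: S_continuous.
  by move=> x; rewrite /= in_itv /=; exact: SY.
have iBY i : mu.-integrable `[a, b] (EFin \o (fun x => \sum_j B x i j * Y j x)).
  have bp j : primitive a b (fun x => 0 + \int[mu]_(t in `[a, x]) (B t i j * Y j t))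
    (fun t => B t i j * Y j t).
    apply: antiderivative.
    have : mu.-integrable `[a, b] (EFin \o (fun x => Y j x * B x i j)).
      by apply: (@integrable_bounded_mul _ _ _ _ M) => // x; rewrite /= in_itv; exact: YM.
    by apply: eq_integrable => // x _ /=; rewrite mulrC.
  by have [] := primitive_sum1 (index_enum 'I_m) bp.
have YE i x : a <= x <= b ->
    Y i x = c i + \int[mu]_(t in `[a, x]) (F i t + \sum_j B t i j * Y j t).
  move=> /[dup] axb /andP[ax xb].
  have sub : (`[a, x]%classic : set R) `<=` `[a, b]%classic.
    by apply: subset_itvl; rewrite bnd_simp.
  have subP t : `[a, x]%classic t -> a <= t <= b.
    by move=> /sub; rewrite /= in_itv.
  have iG N := (S_primitive N i).1.
  have mG : measurable_fun `[a, x] (EFin \o (fun t => F i t + \sum_j B t i j * Y j t)).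
    apply: (measurable_funS _ sub) => //.
    apply/measurable_EFinP/measurable_funD.
      by apply/measurable_EFinP; exact: measurable_int (iF i).
    by apply/measurable_EFinP; exact: measurable_int (iBY i).
  have idom : mu.-integrable `[a, x] (EFin \o (fun t => `|F i t| + M * beta t)).
    apply: (integrable_sub_itv xb).
    have : mu.-integrable `[a, b] (fun t => (`|F i t|%:E + M%:E * (beta t)%:E))%E.
      apply: integrableD => //; first by have := integrable_norm (iF i); apply: eq_integrable.
      by apply: integrableZl => //; exact: h_primitive.1.
    by apply: eq_integrable.
  have [|||iGY _ cvgI] := @dominated_convergence _ _ _ mu `[a, x]%classic (measurable_itv _)
    (fun N => EFin \o (fun t => F i t + \sum_j B t i j * S N j t))
    (EFin \o (fun t => F i t + \sum_j B t i j * Y j t))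
    (EFin \o (fun t => `|F i t| + M * beta t)) _ mG _ idom.
  - by move=> N; exact: measurable_int (integrable_sub_itv xb (iG N)).
  - apply: aeW => t /subP atb; apply: cvg_EFin; first exact: nearW.
    apply: cvgD; first exact: cvg_cst.
    by apply: cvg_bigsum => j; apply: cvgMr; exact: SY.
  - apply: aeW => t N /subP atb /=; rewrite lee_fin.
    rewrite (le_trans (ler_normD _ _))// lerD2l.
    rewrite (le_trans (ler_norm_sum _ _ _))//.
    apply: le_trans (_ : \sum_j `|B t i j| * M <= _).
      by apply: ler_sum => j _; rewrite normrM ler_wpM2l// SM.
    rewrite -mulr_suml mulrC ler_wpM2l//.
    by rewrite (le_trans (normr_ge0 (Y i t)))// YM.
  have SE N : S N.+1 i x = c i + \int[mu]_(t in `[a, x]) (F i t + \sum_j B t i j * S N j t).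
    by have [_ ->//] := S_primitive N i; rewrite S_start.
  have h1 : S N.+1 i x @[N --> \oo] --> Y i x.
    by have := SY i x axb; rewrite -cvg_shiftS.
  have h2 : S N.+1 i x @[N --> \oo] -->
      c i + \int[mu]_(t in `[a, x]) (F i t + \sum_j B t i j * Y j t).
    rewrite (_ : (fun N => S N.+1 i x) = (fun N => c i +
      \int[mu]_(t in `[a, x]) (F i t + \sum_j B t i j * S N j t))); last exact/funext.
    apply: cvgD; first exact: cvg_cst.
    by apply: fine_cvg; rewrite fineK ?integrable_fin_num.
  exact: (cvg_unique _ h1 h2).
move=> i; split.
  by rewrite YE ?lexx ?ltW// antiderivative_start.
have iG : mu.-integrable `[a, b] (EFin \o (fun x => F i x + \sum_j B x i j * Y j x)).
  have : mu.-integrable `[a, b] (fun x => (F i x)%:E + (\sum_j B x i j * Y j x)%:E)%E.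
    by apply: integrableD => //; [exact: iF|exact: iBY].
  by apply: eq_integrable.
apply: eq_primitive (antiderivative (c i) iG) => x.
  by rewrite in_itv => axb; rewrite YE.
by rewrite addrC.
Qed.

End Picard.
End LinearODE.

(** * Controllability of the linear system by forcing its last equation *)

Section Controllability.
Context {R : realType}.
Implicit Types (a b : R) (f g h rho : R -> R).

Local Notation mu := (@lebesgue_measure R).

Lemma ae_exists_itv a b (P : R -> Prop) : a < b ->
  {ae mu, forall x, `[a, b]%classic x -> P x} ->
  forall u v, a <= u -> u < v -> v <= b -> exists2 x, u <= x <= v & P x.
Proof.
move=> ab [N [mN N0 NP]] u v au uv vb; apply: contrapT => nP.
have : (mu `[u, v]%classic <= mu N)%E.
  apply: le_measure; rewrite ?inE//.
  move=> x; rewrite /= in_itv /= => /[dup] uxv /andP[ux xv]; apply: NP => /= h.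
  apply: nP; exists x => //; apply: h.
  by rewrite in_itv /= (le_trans au ux) (le_trans xv vb).
rewrite [leRHS]N0 lebesgue_measure_itv /= lte_fin uv -EFinD lee_fin; lra.
Qed.

Lemma continuous_ae_eq0 a b f : a < b -> {within `[a, b], continuous f} ->
  {ae mu, forall x, `[a, b]%classic x -> f x = 0} -> {in `[a, b], f =1 fun=> 0}.
Proof.
move=> ab fc f0 x; rewrite in_itv /= => /andP[ax xb]; apply/eqP; apply/negPn/negP => fx0.
have /subspace_continuousP/(_ x) := fc; rewrite /= in_itv /= ax xb => /(_ isT).
move=> /cvgrPdist_lt/(_ `|f x|); rewrite normr_gt0 => /(_ fx0).
rewrite near_withinE => /nbhs_ballP[d /= d0 fd].
(* Continuity is only relative to [[a, b]], so a one-sided interval is taken: to the right of [x],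
   except at [x = b], where it lies to the left. *)
have [u [v [au uv vb uvd]]] : exists u v, [/\ a <= u, u < v, v <= b &
    forall t, u <= t <= v -> `|x - t| < d].
  have [xlb|bx] := ltP x b.
    exists x, (Num.min b (x + d / 2)); split=> //.
    - by rewrite lt_min xlb/=; lra.
    - by rewrite ge_min lexx.
    - move=> t; rewrite le_min => /andP[h1 /andP[_ h2]].
      by rewrite distrC ger0_norm; lra.
  exists (Num.max a (x - d / 2)), x; split=> //.
  - by rewrite le_max lexx.
  - by rewrite gt_max; apply/andP; split; lra.
  - move=> t; rewrite ge_max => /andP[/andP[_ h1] h2].
    by rewrite ger0_norm; lra.
have [t utv ft] := ae_exists_itv ab f0 au uv vb.
have /andP[ut tv] := utv.
have := fd t (uvd _ utv); rewrite /= in_itv /= (le_trans au ut) (le_trans tv vb).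
by move=> /(_ isT); rewrite -[ltLHS]/(`|f x - f t|) ft subr0 ltxx.
Qed.

Lemma primitive_zero_density a b f rho : a < b -> primitive a b f rho ->
  {in `[a, b], f =1 fun=> 0} -> {ae mu, forall x, `[a, b]%classic x -> rho x = 0}.
Proof.
move=> ab fp f0; apply: ae_itv_oo_cc.
apply: filterS (primitive_derivable ab fp) => x H; rewrite /= in_itv /= => /andP[ax xb].
have fr : is_derive x 1 f (rho x) by apply: H; rewrite /= in_itv /= !ltW.
have f0' : is_derive x 1 f 0.
  apply: near_eq_is_derive (is_derive_cst 0 x 1).
  near=> y.
  have ay : a < y by near: y; exact: lt_nbhsr.
  have yb : y < b by near: y; exact: lt_nbhsl.
  by rewrite f0// in_itv /= !ltW.
by have /@derive_val <- := fr; have /@derive_val -> := f0'.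
Unshelve. all: by end_near. Qed.

Section System.
Variables (a b : R) (m : nat) (B : R -> 'M[R]_m) (l : 'I_m).
Hypothesis ab : a < b.
Hypothesis lm : l.+1 = m.
Hypothesis iB : forall i j, mu.-integrable `[a, b] (EFin \o (fun x => B x i j)).
Hypothesis B0 : forall i j : 'I_m, (i.+1 < j)%N ->
  {ae mu, forall x, `[a, b]%classic x -> B x i j = 0}.
Hypothesis Bn0 : forall i j : 'I_m, j = i.+1 :> nat ->
  {ae mu, forall x, `[a, b]%classic x -> B x i j != 0}.

Definition system_solution (Y : 'I_m -> R -> R) (F : 'I_m -> R -> R) :=
  forall i, primitive a b (Y i) (fun x => \sum_j B x i j * Y j x + F i x).

Definition adjoint_solution (z : 'I_m -> R -> R) :=
  forall i, primitive a b (z i) (fun x => - \sum_j B x j i * z j x).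

Lemma adjoint_solution_exists (c : 'I_m -> R) :
  exists2 z, adjoint_solution z & forall i, z i a = c i.
Proof.
have iB' i j : mu.-integrable `[a, b] (EFin \o (fun x => (- (B x)^T) i j)).
  have : mu.-integrable `[a, b] (fun x => (-1)%:E * (EFin \o (fun x => B x j i)) x)%E.
    exact: integrableZl.
  by apply: eq_integrable => // x _ /=; rewrite !mxE mulN1e.
have int0 : mu.-integrable `[a, b] (EFin \o (fun=> 0 : R)) by exact: integrable0.
have [z zP] := @linear_ode R a b m (fun x => - (B x)^T) (fun _ _ => 0) c ab iB' (fun=> int0).
exists z => i; last by have [] := zP i.
have [_] := zP i; apply: eq_primitive => // x _.
by rewrite addr0 -sumrN; apply: eq_bigr => j _; rewrite !mxE mulNr.
Qed.

(** Lagrange identity: the contributions of [B] and of its negative transpose cancel, so only the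
    forcing moves the pairing; without forcing it is constant. *)
Lemma adjoint_pairing z Y F : adjoint_solution z -> system_solution Y F ->
  primitive a b (fun x => \sum_i z i x * Y i x) (fun x => \sum_i z i x * F i x).
Proof.
move=> zP YP; have := primitive_sum1 (index_enum 'I_m) (fun i => primitiveM ab (zP i) (YP i)).
apply: eq_primitive => // x _; rewrite big_split /=.
under [X in _ + X]eq_bigr do rewrite mulrDr.
rewrite big_split /= addrA -[RHS]add0r; congr (_ + _).
rewrite -big_split /=.
under eq_bigr do rewrite mulNr mulr_suml mulr_sumr.
rewrite big_split /= sumrN [X in - X + _]exchange_big /= addrC; apply/eqP.
rewrite subr_eq0; apply/eqP.
by apply: eq_bigr => i _; apply: eq_bigr => j _; ring.
Qed.

(** Descending induction from the last component. If all components after [i] vanish, the equation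
    for component [i.+1] reduces to [B x i i.+1 * z i x = 0]: smaller indices are killed by the
    Hessenberg shape of [B], larger ones by induction. The superdiagonal entry is nonzero almost
    everywhere and [z i] is continuous. *)
Lemma adjoint_observable z : adjoint_solution z -> {in `[a, b], z l =1 fun=> 0} ->
  forall i, {in `[a, b], z i =1 fun=> 0}.
Proof.
move=> zP zl.
have step (k : nat) : forall i : 'I_m, (l <= i + k)%N -> {in `[a, b], z i =1 fun=> 0}.
  elim: k => [|k IH] i lik.
    have -> : i = l.
      apply: val_inj; apply/eqP; rewrite /= eqn_leq; rewrite addn0 in lik; rewrite lik andbT.
      by have := ltn_ord i; rewrite -[X in (_ < X)%N]lm ltnS.
    exact: zl.
  have [lik'|ikl] := leqP l (i + k); first exact: IH.
  have i1m : (i.+1 < m)%N.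
    apply: leq_ltn_trans (ltn_ord l); apply: leq_ltn_trans ikl; exact: leq_addr.
  pose j := Ordinal i1m.
  have zj : {in `[a, b], z j =1 fun=> 0} by apply: IH; rewrite /= addSnnS.
  have dz := primitive_zero_density ab (zP j) zj.
  have B0' : {ae mu, forall x, forall p : 'I_m, (p.+1 < j)%N -> `[a, b]%classic x -> B x p j = 0}.
    apply: filter_forall => p; have [pj|jp] := ltnP p.+1 j.
      by apply: filterS (B0 pj) => x.
    by apply: aeW.
  apply: (continuous_ae_eq0 ab); first exact: primitive_continuous (zP i).
  have Bij := Bn0 (erefl : j = i.+1 :> nat).
  apply: filterS3 dz B0' Bij => x h1 h2 h3 abx.
  move: (h1 abx) => /eqP; rewrite oppr_eq0 (bigD1 i)//= big1 ?addr0.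
    by rewrite mulf_eq0 (negbTE (h3 abx)) => /eqP.
  move=> p pi; have [pj|] := ltnP p.+1 j; first by rewrite h2// mul0r.
  rewrite /= ltnS leq_eqVlt eq_sym val_eqE (negbTE pi) /= => ip.
  rewrite (IH p) ?mulr0//; last by move: lik => /leq_trans; apply; rewrite addnS -addSn leq_add2r.
by move=> i; apply: (step m); apply: leq_trans (leq_addl _ _); exact: ltnW.
Qed.

(* The Gram matrix of the last components of a basis of adjoint solutions is
   invertible by observability, so forcing with a combination of these
   components reaches every final value. *)
Lemma controllability (alpha beta : 'I_m -> R) : exists Y f,
  [/\ {within `[a, b], continuous f},
      system_solution Y (fun i x => if i == l then f x else 0),
      (forall i, Y i a = alpha i) & (forall i, Y i b = beta i)].
Proof.
have int0 : mu.-integrable `[a, b] (EFin \o (fun=> 0 : R)) by exact: integrable0.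
have /choice[z zP] : forall i : 'I_m, exists z, adjoint_solution z /\
    forall j, z j a = (i == j)%:R.
  by move=> i; have [z ? ?] := adjoint_solution_exists (fun j => (i == j)%:R); exists z.
have /choice[W WP] : forall i : 'I_m, exists Y : 'I_m -> R -> R,
   system_solution Y (fun _ _ => 0) /\ forall j, Y j a = (i == j)%:R.
  move=> i; have [Y YP] := @linear_ode R a b m B (fun _ _ => 0) (fun j => (i == j)%:R) ab iB (fun=> int0).
  by exists Y; split=> j; have [] := YP j.
pose Z : 'M[R]_m := \matrix_(i, j) z i j b.
(* The pairing of unforced direct and adjoint solutions is constant, so the two fundamental
   matrices, both the identity at [a], still multiply to the identity at [b]. *)
have Zunit : Z \in unitmx.
  pose P : 'M[R]_m := \matrix_(j, k) W k j b.
  suff /mulmx1_unit[] : Z *m P = 1%:M by [].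
  apply/matrixP => i k; rewrite !mxE.
  have [_ /(_ b)] := adjoint_pairing (zP i).1 (WP k).1.
  rewrite (ltW ab) lexx => /(_ isT) H.
  under eq_bigr do rewrite !mxE.
  rewrite H (eq_Rintegral _ (g := fun=> 0)); last first.
    by move=> x _; rewrite big1// => j _; rewrite mulr0.
  rewrite /Rintegral integral0 /= addr0 (bigD1 i)//= (zP i).2 eqxx mul1r (WP k).2.
  rewrite big1 ?addr0; first by rewrite eq_sym.
  by move=> j ji; rewrite (zP i).2 eq_sym (negbTE ji) mul0r.
pose p i j x : R := 0 + \int[mu]_(t in `[a, x]) (z i l t * z j l t).
have zc i j : {within `[a, b], continuous (z i j)} := primitive_continuous ((zP i).1 j).
have cint f : {within `[a, b], continuous f} -> mu.-integrable `[a, b] (EFin \o f).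
  by move=> fc; apply: continuous_compact_integrable => //; exact: segment_compact.
have pP i j : primitive a b (p i j) (fun t => z i l t * z j l t).
  by apply: antiderivative; apply: continuous_integrable_mul => //; exact: cint.
pose G : 'M[R]_m := \matrix_(i, j) p i j b.
have Gunit : G \in unitmx.
  rewrite -row_free_unit; apply: inj_row_free => v vG0.
  (* For [v] in the kernel, [v *m G *m v^T] is the integral of the squared last component of [zeta].
     It vanishes, so [zeta] vanishes by observability, and the initial value of [zeta] is [v]. *)
  pose zeta j x := \sum_i v 0 i * z i j x.
  have zetaP : adjoint_solution zeta.
    move=> j; have := primitive_sum (index_enum 'I_m) (fun i => v 0 i) (fun i => (zP i).1 j).
    apply: eq_primitive => // x _; rewrite /zeta -sumrN.
    under [RHS]eq_bigr do rewrite mulr_sumr -sumrN.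
    rewrite exchange_big /=; apply: eq_bigr => i _.
    by rewrite -sumrN mulr_sumr; apply: eq_bigr => k _; ring.
  have qP := primitive_sum (index_enum 'I_m) (fun i => v 0 i)
    (fun i => primitive_sum (index_enum 'I_m) (fun j => v 0 j) (pP i)).
  have qP' : primitive a b (fun x => \sum_i v 0 i * \sum_j v 0 j * p i j x)
      (fun x => zeta l x ^+ 2).
    apply: eq_primitive qP => // x _; rewrite expr2 /zeta mulr_suml.
    apply: eq_bigr => i _; rewrite !mulr_sumr; apply: eq_bigr => j _; ring.
  have zeta2 : \int[mu]_(t in `[a, b]) (zeta l t ^+ 2) = 0.
    rewrite (primitive_itv (ltW ab) qP') [X in _ - X]big1 ?subr0; last first.
      by move=> i _; rewrite big1 ?mulr0// => j _; rewrite /p antiderivative_start mulr0.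
    transitivity ((v *m G *m v^T) 0 0); last by rewrite vG0 mul0mx mxE.
    rewrite !mxE; under eq_bigr do rewrite mulr_sumr.
    rewrite exchange_big /=; apply: eq_bigr => j _.
    rewrite !mxE mulr_suml; apply: eq_bigr => i _; rewrite !mxE; ring.
  have zetac : {within `[a, b], continuous (zeta l)} := primitive_continuous (zetaP l).
  have zeta0 : {in `[a, b], zeta l =1 fun=> 0}.
    apply: (continuous_ae_eq0 ab zetac).
    have i2 := qP'.1.
    have /(ae_eq_integral_abs mu (measurable_itv _)) : (\int[mu]_(x in `[a, b]) `|(zeta l x ^+ 2)%:E|)%E = 0%E.
      under eq_integral do rewrite gee0_abs ?lee_fin ?sqr_ge0//.
      by rewrite -[LHS]fineK ?integrable_fin_num//; congr EFin.
    move=> /(_ (measurable_int _ i2)); apply: filterS => x H /H [] /eqP.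
    by rewrite sqrf_eq0 => /eqP.
  have z0 := adjoint_observable zetaP zeta0.
  apply/rowP => j; rewrite mxE -(z0 j a); last by rewrite in_itv /= lexx ltW.
  rewrite /zeta (bigD1 j)//= (zP j).2 eqxx mulr1 big1 ?addr0// => i ij.
  by rewrite (zP i).2 (negbTE ij) mulr0.
have [Y1 Y1P] := @linear_ode R a b m B (fun _ _ => 0) alpha ab iB (fun=> int0).
(* The unforced solution [Y1] takes care of the initial values, and [w] is the final error left to a
   forced solution [Y2] starting at zero. The pairings of [Y2] with the adjoint basis at [b] are the
   entries of [G *m c], which dictates the equation [G *m c = Z *m w]. *)
pose w : 'cV[R]_m := \col_i (beta i - Y1 i b).
pose c := invmx G *m (Z *m w).
pose f x := \sum_j c j 0 * z j l x.
have fp : exists rho, primitive a b f rho.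
  eexists; apply: primitive_sum => j; exact: (zP j).1.
have fc : {within `[a, b], continuous f}.
  by have [rho /primitive_continuous] := fp.
pose F i x := if i == l then f x else 0.
have iF i : mu.-integrable `[a, b] (EFin \o F i).
  by rewrite /F; case: (i == l) => //; exact: cint.
have [Y2 Y2P] := @linear_ode R a b m B F (fun=> 0) ab iB iF.
have Y2b i : Y2 i b = w i 0.
  suff ZY : Z *m (\col_i Y2 i b) = Z *m w.
    have := congr1 (fun M => (invmx Z *m M) i 0) ZY.
    by rewrite !mulKmx// mxE.
  have GcZw : G *m c = Z *m w by rewrite /c mulKVmx.
  rewrite -GcZw; apply/matrixP => k o; rewrite !mxE.
  have pair := adjoint_pairing (zP k).1 (fun i => (Y2P i).2).
  have := primitive_itv (ltW ab) pair.
  rewrite [X in _ - X]big1 ?subr0; last by move=> j _; rewrite (Y2P j).1 mulr0.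
  move=> H; under eq_bigr do rewrite !mxE.
  rewrite -H.
  have qP := primitive_sum (index_enum 'I_m) (fun j => c j 0) (pP k).
  have := primitive_itv (ltW ab) qP.
  rewrite [X in _ - X]big1 ?subr0; last first.
    by move=> j _; rewrite /p antiderivative_start mulr0.
  rewrite (_ : \sum_j G k j * c j o = \sum_i c i 0 * p k i b); last first.
    by apply: eq_bigr => j _; rewrite mxE ord1 mulrC.
  move=> <-; apply: eq_Rintegral => x _.
  rewrite (bigD1 l)//= /F eqxx big1 ?addr0; last by move=> j /negbTE ->; rewrite mulr0.
  by rewrite /f mulr_sumr; apply: eq_bigr => j _; ring.
exists (fun i x => Y1 i x + Y2 i x), f; split => //.
- move=> i; apply: eq_primitive (primitiveD (Y1P i).2 (Y2P i).2) => // x _.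
  rewrite addr0 addrA -big_split /=; congr (_ + _); apply: eq_bigr => j _.
  by rewrite mulrDr.
- by move=> i; rewrite (Y1P i).1 (Y2P i).1 addr0.
- by move=> i; rewrite Y2b mxE; ring.
Qed.

End System.
End Controllability.

(** * Borel measurability of derivatives *)

Section DerivativeMeasurable.
Context {R : realType}.
Implicit Types (a b x : R) (f g : R -> R).

Local Notation mu := (@lebesgue_measure R).

Lemma bigcap_rat_measurable (S : rat * rat -> set R) :
  (forall p, measurable (S p)) -> measurable (\bigcap_p S p).
Proof.
move=> mS.
have -> : \bigcap_p S p = \bigcap_n (if unpickle n is Some p then S p else setT).
  apply/seteqP; split=> x h.
    by move=> n _; case: (unpickle n) => // p; exact: h.
  by move=> p _; have := h (pickle p) Logic.I; rewrite pickleK.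
by apply: bigcapT_measurable => n; case: (unpickle n).
Qed.

Let quotient g (h x : R) := h^-1 * (g (h + x) - g x).

Let smallP (n : nat) (h : R) := (h != 0) && (`|h| < n.+1%:R^-1).

Let cauchy_set g k n := \bigcap_(p : rat * rat)
  [set x | smallP n (ratr p.1) -> smallP n (ratr p.2) ->
     `|quotient g (ratr p.1) x - quotient g (ratr p.2) x| <= k.+1%:R^-1].

Let derivable_set g := \bigcap_k \bigcup_n cauchy_set g k n.

Let measurable_quotient g h : continuous g -> measurable_fun setT (quotient g h).
Proof.
move=> gc; apply: measurable_funM => //; apply: measurable_funB.
  apply: continuous_measurable_fun => x; apply: (@continuous_comp _ _ _ (fun x => h + x) g).
    by apply: cvgD; [exact: cvg_cst|exact: cvg_id].
  exact: gc.
exact: continuous_measurable_fun.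
Qed.

Let measurable_derivable_set g : continuous g -> measurable (derivable_set g).
Proof.
move=> gc; apply: bigcapT_measurable => k; apply: bigcupT_measurable => n.
apply: bigcap_rat_measurable => p.
have [p1|p1] := boolP (smallP n (ratr p.1)); last first.
  by rewrite (_ : mkset _ = setT) //; apply/seteqP; split=> x.
have [p2|p2] := boolP (smallP n (ratr p.2)); last first.
  by rewrite (_ : mkset _ = setT) //; apply/seteqP; split=> x.
rewrite (_ : mkset _ = (fun x => `|quotient g (ratr p.1) x - quotient g (ratr p.2) x|)
    @^-1` `]-oo, k.+1%:R^-1]).
  have mq : measurable_fun setT
      (fun x => `|quotient g (ratr p.1) x - quotient g (ratr p.2) x|).
    apply: measurableT_comp => //.
    by apply: measurable_funB; exact: measurable_quotient.
  by have := mq measurableT _ (measurable_itv `]-oo, k.+1%:R^-1]); rewrite setTI.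
apply/seteqP; split=> x /=; rewrite in_itv /=; last by [].
by apply.
Qed.

(** Away from zero the difference quotient is continuous in its increment, so testing rational
    increments loses nothing. *)
Let quotient_rat_approx g x h n (e : R) : {for h + x, continuous g} -> smallP n h -> 0 < e ->
  exists2 p : rat, smallP n (ratr p) & `|quotient g (ratr p) x - quotient g h x| < e.
Proof.
move=> gc /andP[h0 hn] e0.
have qc : quotient g t x @[t --> h] --> quotient g h x.
  apply: cvgM; first by apply: cvgV => //; exact: cvg_id.
  apply: cvgB; last exact: cvg_cst.
  apply: (cvg_comp (fun t => t + x) g _ gc).
  by apply: cvgD; [exact: cvg_id|exact: cvg_cst].
have /cvgrPdist_lt/(_ e e0) qd := qc.
have near_h : \forall t \near h, smallP n t /\ `|quotient g t x - quotient g h x| < e.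
  near=> t; split.
    apply/andP; split; near: t; first exact: (cvgr_neq0 _ cvg_id h0).
    exact: (cvgr_norm_lt _ cvg_id).
  rewrite distrC; near: t; exact: qd.
have /nbhs_ballP[d /= d0 hd] := near_h.
have hhd : h < h + d by rewrite ltrDl.
have [p pin] := rat_in_itvoo hhd.
move: pin; rewrite in_itv /= => /andP[p1 p2].
have /hd[sp qp] : ball h d (ratr p : R).
  by rewrite /ball /= distrC gtr0_norm ?subr_gt0// ltrBlDl.
by exists p.
Unshelve. all: by end_near. Qed.

Let derivable_setP g x : continuous g -> derivable_set g x <-> derivable g x 1.
Proof.
move=> gc.
have qE (h : R) : h^-1 *: ((g \o shift x) (h *: (1 : R^o)) - g x) = quotient g h x.
  by rewrite /quotient /= /GRing.scale /= mulr1.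
split=> [Dx|].
  have cauchy_q : forall e : R, 0 < e -> exists n, forall h h', smallP n h -> smallP n h' ->
     `|quotient g h x - quotient g h' x| < e.
    move=> e e0; have e40 : 0 < e / 4 by rewrite divr_gt0.
    have [k ke] : exists k : nat, k.+1%:R^-1 < e / 4.
      exists (Num.bound (e / 4)^-1); rewrite invf_plt ?posrE//.
      apply: lt_trans (archi_boundP _) _; first by rewrite invr_ge0 ltW.
      by rewrite ltr_nat.
    have [n _ Dn] := Dx k Logic.I; exists n => h h' nh nh'.
    have [p np pE] := quotient_rat_approx (gc _) nh e40 (x := x).
    have [p' np' p'E] := quotient_rat_approx (gc _) nh' e40 (x := x).
    have := Dn (p, p') Logic.I np np' => /=.
    move: pE p'E; set q1 := quotient g (ratr p) x; set q2 := quotient g (ratr p') x.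
    set q := quotient g h x; set q' := quotient g h' x => pE p'E pp'.
    have -> : q - q' = - (q1 - q) + ((q1 - q2) + (q2 - q')) by ring.
    apply: le_lt_trans (ler_normD _ _) _; rewrite normrN.
    by have := le_lt_trans pp' ke; have := ler_normD (q1 - q2) (q2 - q'); lra.
  apply/cauchy_cvgP/cauchyP => e e0.
  have [n nP] := cauchy_q _ e0.
  (* One fixed admissible increment; its quotient is the center that [cauchyP] asks for. *)
  pose h0 : R := n.+1%:R^-1 / 2.
  have h0n : smallP n h0.
    have h00 : 0 < h0 by rewrite divr_gt0// invr_gt0.
    by rewrite /smallP gt_eqF//= gtr0_norm// ltr_pdivrMr// ltr_pMr ?ltr1n// invr_gt0.
  exists (quotient g h0 x).
  rewrite nbhs_simpl /=; near=> h.
  rewrite /ball /= qE; apply: nP => //.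
  apply/andP; split; first by near: h; exact: nbhs_dnbhs_neq.
  by near: h; apply: dnbhs0_lt; rewrite invr_gt0.
move=> dg k _; have /cvgrPdist_lt/(_ (k.+1%:R^-1 / 2)) := dg.
rewrite divr_gt0// => /(_ isT) /nbhs_ballP[d /= d0 hd].
exists (Num.bound d^-1) => // -[p p'] _ /= /andP[p0 pn] /andP[p'0 p'n].
have dn : (Num.bound d^-1).+1%:R^-1 < d.
  rewrite invf_plt ?posrE//.
  apply: lt_trans (archi_boundP _) _; first by rewrite invr_ge0 ltW.
  by rewrite ltr_nat.
have inb (t : R) : t != 0 -> `|t| < (Num.bound d^-1).+1%:R^-1 ->
    `|'D_1 g x - quotient g t x| < k.+1%:R^-1 / 2.
  move=> t0 td; rewrite -qE; apply: hd => //.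
  by rewrite /ball /= sub0r normrN (lt_trans td).
have h1 := inb _ p0 pn; have h2 := inb _ p'0 p'n.
have h3 := ler_normD (quotient g (ratr p) x - 'D_1 g x) ('D_1 g x - quotient g (ratr p') x).
rewrite addrA subrK in h3; rewrite distrC in h1.
by move: h1 h2 h3; move: (k.+1%:R^-1) => K; lra.
Unshelve. all: by end_near. Qed.

(* The set where a continuous function is derivable is Borel, being described
   by a Cauchy condition on difference quotients at rational increments. *)
Lemma measurable_derive1 g : continuous g -> measurable_fun setT (derive1 g).
Proof.
move=> gc; have mD := measurable_derivable_set gc.
(* Where [g] is not derivable, [derive1] is the limit of a divergent filter, whose default value is
   [point]; the approximating sequence takes the same value there. *)
pose u n x := if x \in derivable_set g then quotient g n.+1%:R^-1 x else (point : R).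
apply: (@measurable_fun_cvg _ _ _ _ u).
  move=> n; apply: measurable_fun_ifT => //; last exact: measurable_quotient.
  apply: (measurable_fun_bool true) => //; rewrite setTI.
  rewrite (_ : _ @^-1` _ = derivable_set g)//.
  by apply/seteqP; split=> x /=; [exact: set_mem|exact: mem_set].
move=> x _; rewrite /u; case: (boolP (x \in derivable_set g)) => xD.
  have dg : derivable g x 1 by apply/derivable_setP => //; rewrite inE in xD.
  rewrite derive1E.
  have /cvgr_dnbhsP/(_ harmonic) := (dg : _ --> 'D_1 g x).
  move=> H.
  apply: cvg_trans (H _).
    by apply: near_eq_cvg; apply: nearW => n; rewrite /quotient /= /GRing.scale /= mulr1.
  by split; [move=> n; rewrite invr_neq0// pnatr_eq0|exact: cvg_harmonic].
rewrite derive1E /derive dvgP//; first exact: cvg_cst.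
by move=> dg; move: xD; rewrite notin_setE; apply; apply/derivable_setP.
Qed.

End DerivativeMeasurable.

(** * Complex-valued absolutely continuous functions and their derivatives *)

Section ComplexCalculus.
Context {R : realType}.
Implicit Types (a b x : R) (f g : R -> R[i]).

Local Notation mu := (@lebesgue_measure R).
Local Notation Re := complex.Re.
Local Notation Im := complex.Im.

Lemma ReM (z w : R[i]) : Re (z * w) = Re z * Re w - Im z * Im w.
Proof. by case: z w => [? ?] [? ?]. Qed.

Lemma ImM (z w : R[i]) : Im (z * w) = Re z * Im w + Im z * Re w.
Proof. by case: z w => [? ?] [? ?]. Qed.

Lemma normc_ge_Im (z : R[i]) : `|Im z|%:C <= `|z|.
Proof.
case: z => u v; rewrite normc_def /= lecR -sqrtr_sqr ler_sqrt.
  by rewrite lerDr sqr_ge0.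
by rewrite addr_ge0 ?sqr_ge0.
Qed.

Lemma abs_continuousP a b f : a < b -> abs_continuous a b f <->
  exists rho sigma, primitive a b (fun x => Re (f x)) rho /\
    primitive a b (fun x => Im (f x)) sigma.
Proof.
move=> ab; split=> [fac|[rho [sigma [fr fi]]]].
  have [rho rP] := ac_density ab (abs_continuous_ac (h := @complex.Re R)
    (fun z w => ltac:(rewrite -raddfB; exact: normc_ge_Re)) fac).
  have [sigma sP] := ac_density ab (abs_continuous_ac (h := @complex.Im R)
    (fun z w => ltac:(rewrite -raddfB; exact: normc_ge_Im)) fac).
  by exists rho, sigma.
have -> : f = fun x => Re (f x) +i* Im (f x) by apply/funext => x; case: (f x).
exact: primitive_abs_continuous fr fi.
Qed.

Lemma eq_abs_continuous a b f g : {in `[a, b], f =1 g} ->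
  abs_continuous a b f -> abs_continuous a b g.
Proof.
move=> fg fac e /fac[d d0 fd]; exists d => // N u v uv tI sd.
under eq_bigr => j _.
  have [h1 h2 h3] := uv j.
  rewrite -!fg ?in_itv /= ?h1 ?h3 ?(le_trans h1 h2) ?(le_trans h2 h3)//; over.
exact: fd.
Qed.

Lemma abs_continuous_lin a b c f g : a < b -> abs_continuous a b f ->
  abs_continuous a b g -> abs_continuous a b (fun x => c * f x + g x).
Proof.
move=> ab /(abs_continuousP _ ab)[r1 [s1 [f1 f2]]] /(abs_continuousP _ ab)[r2 [s2 [g1 g2]]].
apply/abs_continuousP => //; do 2 eexists; split.
  have := primitiveZD (Re c) f1 (primitiveZD (- Im c) f2 g1).
  apply: eq_primitive => x _ //; rewrite raddfD /= ReM; ring.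
have := primitiveZD (Re c) f2 (primitiveZD (Im c) f1 g2).
apply: eq_primitive => x _ //; rewrite raddfD /= ImM; ring.
Qed.

Lemma abs_continuous_conj a b f : a < b -> abs_continuous a b f ->
  abs_continuous a b (fun x => conjc (f x)).
Proof.
move=> ab /(abs_continuousP _ ab)[r [s [f1 f2]]].
apply/abs_continuousP => //; do 2 eexists; split.
  by apply: eq_primitive f1 => x _ //; case: (f x).
have := primitiveZD (-1) f2 (primitive0 a b).
by apply: eq_primitive => x _ //; rewrite addr0 mulN1r; case: (f x).
Qed.

Lemma abs_continuous_derivable a b f : a < b -> abs_continuous a b f ->
  {ae mu, forall x, `[a, b]%classic x ->
    derivable (fun t => Re (f t)) x 1 /\ derivable (fun t => Im (f t)) x 1}.
Proof.
move=> ab /(abs_continuousP _ ab)[r [s [f1 f2]]].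
apply: filterS2 (primitive_derivable ab f1) (primitive_derivable ab f2) => x h1 h2 abx.
have d1 := h1 abx; have d2 := h2 abx.
by split; [exact: (@ex_derive _ _ _ _ _ _ _ d1)|exact: (@ex_derive _ _ _ _ _ _ _ d2)].
Qed.

Lemma cderiv_lin c f g x :
  derivable (fun t => Re (f t)) x 1 -> derivable (fun t => Im (f t)) x 1 ->
  derivable (fun t => Re (g t)) x 1 -> derivable (fun t => Im (g t)) x 1 ->
  cderiv (fun t => c * f t + g t) x = c * cderiv f x + cderiv g x.
Proof.
move=> f1 f2 g1 g2; rewrite /cderiv !derive1E.
have lin (p q : R) (u v w : R -> R) : derivable u x 1 -> derivable v x 1 ->
    derivable w x 1 ->
    'D_1 (fun t => p * u t + q * v t + w t) x = p * 'D_1 u x + q * 'D_1 v x + 'D_1 w x.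
  move=> du dv dw.
  have du' : is_derive x 1 u ('D_1 u x) := DeriveDef du erefl.
  have dv' : is_derive x 1 v ('D_1 v x) := DeriveDef dv erefl.
  have dw' : is_derive x 1 w ('D_1 w x) := DeriveDef dw erefl.
  have H := is_deriveD (is_deriveD (is_deriveZ p du') (is_deriveZ q dv')) dw'.
  exact: (@derive_val _ _ _ _ _ _ _ H).
have -> : (fun t => Re (c * f t + g t)) =
    (fun t => Re c * Re (f t) + (- Im c) * Im (f t) + Re (g t)).
  by apply/funext => t; rewrite raddfD /= ReM; ring.
have -> : (fun t => Im (c * f t + g t)) =
    (fun t => Re c * Im (f t) + Im c * Re (f t) + Im (g t)).
  by apply/funext => t; rewrite raddfD /= ImM; ring.
rewrite (lin _ _ _ _ _ f1 f2 g1) (lin _ _ _ _ _ f2 f1 g2).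
by case: c => p q; simpc; congr (_ +i* _); ring.
Qed.

Lemma cderiv_conj f x : derivable (fun t => Im (f t)) x 1 ->
  cderiv (fun t => conjc (f t)) x = conjc (cderiv f x).
Proof.
move=> df; rewrite /cderiv !derive1E /=.
have -> : (fun t => Re (conjc (f t))) = (fun t => Re (f t)).
  by apply/funext => t; case: (f t).
have -> : (fun t => Im (conjc (f t))) = - (fun t => Im (f t)).
  by apply/funext => t; rewrite -[RHS]/(- Im (f t)); case: (f t).
by rewrite deriveN.
Qed.

Lemma eq_derive1 a b (f g : R -> R) x : a < x < b -> {in `[a, b], f =1 g} ->
  derive1 f x = derive1 g x.
Proof.
move=> /andP[ax xb] fg; rewrite !derive1E.
apply: near_eq_derive.
near=> y; apply: fg; rewrite in_itv /=.
apply/andP; split; apply/ltW; near: y; [exact: lt_nbhsr|exact: lt_nbhsl].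
Unshelve. all: by end_near. Qed.

Lemma eq_cderiv a b f g x : a < x < b -> {in `[a, b], f =1 g} -> cderiv f x = cderiv g x.
Proof.
move=> axb fg; rewrite /cderiv.
by congr (_ +i* _); apply: (eq_derive1 axb) => t /fg ->.
Qed.

Lemma cderiv_primitive a b f rho sigma : a < b ->
  primitive a b (fun x => Re (f x)) rho -> primitive a b (fun x => Im (f x)) sigma ->
  {ae mu, forall x, `[a, b]%classic x -> cderiv f x = rho x +i* sigma x}.
Proof.
move=> ab f1 f2.
apply: filterS2 (primitive_derivable ab f1) (primitive_derivable ab f2) => x h1 h2 abx.
have d1 := h1 abx; have d2 := h2 abx; rewrite /cderiv !derive1E.
by congr (_ +i* _); apply: derive_val.
Qed.

Definition cmeasurable (D : set R) f :=
  measurable_fun D (fun x => Re (f x)) /\ measurable_fun D (fun x => Im (f x)).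

Lemma cmeasurableD D f g : cmeasurable D f -> cmeasurable D g ->
  cmeasurable D (fun x => f x + g x).
Proof.
move=> [f1 f2] [g1 g2]; split.
  by under eq_fun do rewrite raddfD /=; exact: measurable_funD.
by under eq_fun do rewrite raddfD /=; exact: measurable_funD.
Qed.

Lemma cmeasurableM D f g : cmeasurable D f -> cmeasurable D g ->
  cmeasurable D (fun x => f x * g x).
Proof.
move=> [f1 f2] [g1 g2]; split.
  by under eq_fun do rewrite ReM /=; apply: measurable_funB; exact: measurable_funM.
by under eq_fun do rewrite ImM /=; apply: measurable_funD; exact: measurable_funM.
Qed.

Lemma cmeasurable_cst D (c : R[i]) : cmeasurable D (fun=> c).
Proof. by split; exact: measurable_cst. Qed.

Lemma cmeasurable_sum D (I : Type) (s : seq I) (f : I -> R -> R[i]) :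
  (forall i, cmeasurable D (f i)) -> cmeasurable D (fun x => \sum_(i <- s) f i x).
Proof.
move=> fm; elim: s => [|i s IH].
  by under eq_fun do rewrite big_nil; exact: cmeasurable_cst.
under eq_fun do rewrite big_cons; exact: cmeasurableD.
Qed.

Lemma abs_continuous_within a b f : a < b -> abs_continuous a b f ->
  {within `[a, b], continuous (fun x => Re (f x))} /\
  {within `[a, b], continuous (fun x => Im (f x))}.
Proof.
move=> ab /(abs_continuousP _ ab)[r [s [f1 f2]]].
by split; [exact: primitive_continuous f1|exact: primitive_continuous f2].
Qed.

Lemma abs_continuous_measurable a b f : a < b -> abs_continuous a b f ->
  cmeasurable `[a, b]%classic f.
Proof.
move=> ab /(abs_continuous_within ab)[f1 f2].
by split; apply: subspace_continuous_measurable_fun.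
Qed.

Lemma abs_continuous_L2 a b f : a < b -> abs_continuous a b f -> L2_fun a b f.
Proof.
move=> ab fac; have [m1 m2] := abs_continuous_measurable ab fac; split=> //.
have [c1 c2] := abs_continuous_within ab fac.
have cint (g : R -> R) : {within `[a, b], continuous g} ->
    mu.-integrable `[a, b] (EFin \o g).
  by move=> gc; apply: continuous_compact_integrable => //; exact: segment_compact.
have i1 := continuous_integrable_mul c1 (cint _ c1).
have i2 := continuous_integrable_mul c2 (cint _ c2).
have : mu.-integrable `[a, b] (fun x => (Re (f x) * Re (f x))%:E + (Im (f x) * Im (f x))%:E)%E.
  exact: integrableD.
by apply: eq_integrable.
Qed.

(** Clipping the argument to [[a, b]] turns [f] into a continuous function on the whole line with
    the same derivative on []a, b[]. At the endpoints the derivatives may differ, but every function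
    is measurable on a singleton. *)
Lemma within_continuous_derive1_measurable a b (f : R -> R) : a < b ->
  {within `[a, b], continuous f} -> measurable_fun `[a, b] (derive1 f).
Proof.
move=> ab fc.
pose clip x := Num.max a (Num.min b x).
have clip_id x : a <= x <= b -> clip x = x.
  by move=> /andP[ax xb]; rewrite /clip min_r// max_r.
have clipc : continuous clip.
  move=> x; apply: continuous_max; first exact: cvg_cst.
  by apply: continuous_min; [exact: cvg_cst|exact: cvg_id].
have clip_in x : `[a, b]%classic (clip x).
  by rewrite /= in_itv /= /clip le_max lexx ge_max ge_min lexx (ltW ab).
have gc : continuous (f \o clip).
  move=> x; apply: (cvg_comp clip f (G := within `[a, b] (nbhs (clip x)))).
    move=> P; rewrite /within /= => nP; have := clipc x; move=> /(_ _ nP) H.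
    near=> t; have : clip t \in `[a, b] -> P (clip t) by near: t; exact: H.
    by apply; exact: clip_in.
  by have /subspace_continuousP := fc; apply.
have moo : measurable_fun `]a, b[ (derive1 f).
  apply: (eq_measurable_fun (derive1 (f \o clip))).
    move=> x; rewrite inE /= in_itv /= => axb; apply: (eq_derive1 axb) => t.
    by rewrite in_itv /= => atb; rewrite /= clip_id.
  by apply: measurable_funTS; exact: measurable_derive1.
have -> : `[a, b]%classic = `]a, b[ `|` [set a; b] :> set R.
  apply/seteqP; split=> x /=; rewrite !in_itv /=; last first.
    by move=> [/andP[ax xb]|[|] ->]; rewrite ?lexx ?ltW.
  move=> /andP[ax xb]; have [->|xa] := eqVneq x a; first by right; left.
  have [->|xb'] := eqVneq x b; first by right; right.
  by left; rewrite !lt_neqAle eq_sym xa ax xb' xb.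
apply/measurable_funU => //; first exact: measurableU.
split=> //; apply/measurable_funU => //; split; exact: measurable_fun_set1.
Unshelve. all: by end_near. Qed.

Lemma cderiv_measurable a b f : a < b -> abs_continuous a b f ->
  cmeasurable `[a, b]%classic (cderiv f).
Proof.
by move=> ab /(abs_continuous_within ab)[c1 c2]; split;
  exact: within_continuous_derive1_measurable.
Qed.

Lemma abs_continuous_ae_eq a b f g : a < b -> abs_continuous a b f ->
  abs_continuous a b g -> ae_eq mu `[a, b]%classic f g -> {in `[a, b], f =1 g}.
Proof.
move=> ab fac gac fg x xab.
have [c1 c2] := abs_continuous_within ab (abs_continuous_lin (-1) ab gac fac).
have h1 := continuous_ae_eq0 ab c1; have h2 := continuous_ae_eq0 ab c2.
have fg0 : {ae mu, forall x, `[a, b]%classic x -> -1 * g x + f x = 0}.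
  by apply: filterS fg => t h abt; rewrite h// mulN1r addNr.
apply/eqP; rewrite -subr_eq0 addrC -mulN1r eq_complex; apply/andP; split; apply/eqP.
  by apply: h1 => //; apply: filterS fg0 => t h abt; rewrite h.
by apply: h2 => //; apply: filterS fg0 => t h abt; rewrite h.
Qed.

(** Only the integral is transferred from [g]; Borel measurability of [f] has to be supplied, since
    almost everywhere equality does not preserve it. *)
Lemma L2_fun_ae_eq a b f g : cmeasurable `[a, b]%classic f ->
  ae_eq mu `[a, b]%classic f g -> L2_fun a b g -> L2_fun a b f.
Proof.
move=> [f1 f2] fg [g1 g2 /integrableP[mg ig]]; split=> //.
have mf : measurable_fun `[a, b] (fun x => (Re (f x) ^+ 2 + Im (f x) ^+ 2)%:E).
  by apply/measurable_EFinP; exact: L2_funP.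
apply/integrableP; split=> //; apply: le_lt_trans ig.
rewrite le_eqVlt; apply/orP; left; apply/eqP; apply: ae_eq_integral => //.
- exact: measurableT_comp.
- exact: measurableT_comp.
- by apply: filterS fg => x h abx; rewrite /= h.
Qed.

End ComplexCalculus.

(** * Quasi-derivatives *)

Section QuasiDerivatives.
Context {R : realType} (a b : R) (m : nat) (A : R -> 'M[R[i]]_m).
Hypothesis ab : a < b.
Hypothesis m_gt0 : (0 < m)%N.
Hypothesis szA : shin_zettl a b A.
Hypothesis realA : real_entries a b A.
Implicit Types (Y : nat -> R -> R[i]) (F y : R -> R[i]) (u v : nat -> R[i]).

Local Notation mu := (@lebesgue_measure R).
Local Notation Re := complex.Re.
Local Notation Im := complex.Im.

Definition quasi_remainder Y (k : nat) (x : R) : R[i] :=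
  cderiv (Y k) x - \sum_(s < k.+1) entry A k s x * Y s x.

(* First-order form: Y k stands for the k-th quasi-derivative and F for the
   quasi-derivative of order m. *)
Definition quasi_system Y F : Prop :=
  [/\ (forall k, (k < m)%N -> abs_continuous a b (Y k)),
      (forall k, (k.+1 < m)%N -> ae_eq mu `[a, b]%classic
         (fun x => entry A k k.+1 x * Y k.+1 x) (quasi_remainder Y k))
    & ae_eq mu `[a, b]%classic F (quasi_remainder Y m.-1)].

Let D y k := nth (fun=> 0) (quasi_derivs a b A y k) k.

Let size_quasi_derivs y k : size (quasi_derivs a b A y k) = k.+1.
Proof. by elim: k => //= k IH; rewrite size_rcons IH. Qed.

Let nth_quasi_derivs y k s : (s <= k)%N -> nth (fun=> 0) (quasi_derivs a b A y k) s = D y s.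
Proof.
elim: k => [|k IH]; first by rewrite leqn0 => /eqP ->.
rewrite leq_eqVlt => /predU1P[->//|]; rewrite ltnS => sk.
by rewrite /= nth_rcons size_quasi_derivs ltnS sk IH.
Qed.

Let qd_remainderE y k : qd_remainder A k (quasi_derivs a b A y k) = quasi_remainder (D y) k.
Proof.
apply/funext => x; rewrite /qd_remainder /quasi_remainder; congr (_ - _).
by apply: eq_bigr => s _; rewrite nth_quasi_derivs// -ltnS.
Qed.

Let D_S y k : D y k.+1 = ac_representative a b
  (fun x => (entry A k k.+1 x)^-1 * quasi_remainder (D y) k x).
Proof. by rewrite {1}/D /= nth_rcons size_quasi_derivs ltnn eqxx qd_remainderE. Qed.

Let quasi_deriv_lt y k : (k < m)%N -> quasi_deriv a b A k y = D y k.
Proof. by rewrite /quasi_deriv => ->. Qed.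

Let quasi_deriv_m y : quasi_deriv a b A m y = quasi_remainder (D y) m.-1.
Proof. by rewrite /quasi_deriv ltnn qd_remainderE. Qed.

Let eq_quasi_remainder Y Y' k : (forall s, (s <= k)%N -> Y s = Y' s) ->
  quasi_remainder Y k = quasi_remainder Y' k.
Proof.
move=> YY'; apply/funext => x; rewrite /quasi_remainder YY'//; congr (_ - _).
by apply: eq_bigr => s _; rewrite YY'// -ltnS.
Qed.

Let entry_neq0 k : (k.+1 < m)%N ->
  {ae mu, forall x, `[a, b]%classic x -> entry A k k.+1 x != 0}.
Proof.
move=> k1m; have km := ltnW k1m; case: szA => _ _ /(_ (Ordinal km) (Ordinal k1m) erefl).
apply: filterS => x; rewrite /entry !insubT//=.
Qed.

Let entryE (k s : nat) x (km : (k < m)%N) (sm : (s < m)%N) :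
  entry A k s x = A x (Ordinal km) (Ordinal sm).
Proof. by rewrite /entry !insubT. Qed.

Let entry_measurable k s : cmeasurable `[a, b]%classic (entry A k s).
Proof.
rewrite /entry; case: insubP => [i _ _|_]; last exact: cmeasurable_cst.
case: insubP => [j _ _|_]; last exact: cmeasurable_cst.
have [_ /(_ i j)[i1 i2] _] := szA.
by split; apply/measurable_EFinP; [exact: measurable_int i1|exact: measurable_int i2].
Qed.

Let entry_real k s : {ae mu, forall x, `[a, b]%classic x -> conjc (entry A k s x) = entry A k s x}.
Proof.
have [km|km] := ltnP k m; last first.
  by apply: aeW => x _; rewrite /entry insubF ?conjc0//; apply/negbTE; rewrite -leqNgt.
have [sm|sm] := ltnP s m; last first.
  apply: aeW => x _; rewrite /entry; case: insub => [i|]; last exact: conjc0.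
  by rewrite insubF ?conjc0//; apply/negbTE; rewrite -leqNgt.
apply: filterS (realA (Ordinal km) (Ordinal sm)) => x h abx.
by rewrite entryE; move: (h abx); case: (A x _ _) => p q /= ->; rewrite oppr0.
Qed.

Lemma ac_representative_ae f : abs_continuous a b (ac_representative a b f) ->
  ae_eq mu `[a, b]%classic (ac_representative a b f) f.
Proof.
rewrite /ac_representative; case: xgetP => [g _ [_ //]|_ _]; exact: ae_eq_refl.
Qed.

(** Continuity makes an absolutely continuous representative unique on [[a, b]], so the choice made
    by [xget] is harmless there. *)
Lemma ac_representativeP f g : abs_continuous a b g -> ae_eq mu `[a, b]%classic g f ->
  abs_continuous a b (ac_representative a b f) /\ {in `[a, b], ac_representative a b f =1 g}.
Proof.
move=> gac gf.
have [h1 h2] : [set g | abs_continuous a b g /\ ae_eq mu `[a, b]%classic g f]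
   (ac_representative a b f) by apply: (@xgetPex _ f); exists g.
split=> //; apply: abs_continuous_ae_eq => //.
by apply: filterS2 h2 gf => x e1 e2 abx; rewrite e1// e2.
Qed.

Lemma quasi_system_quasi_deriv y : qd_dom a b A y ->
  quasi_system (fun k => quasi_deriv a b A k y) (quasi_deriv a b A m y).
Proof.
move=> ydom; split=> //.
- move=> k k1m; have := ydom _ k1m; rewrite quasi_deriv_lt// D_S.
  move=> /ac_representative_ae.
  rewrite (@eq_quasi_remainder _ (D y)); last first.
    by move=> s sk; rewrite quasi_deriv_lt// (leq_ltn_trans sk)// ltnW.
  apply: filterS2 (entry_neq0 k1m) => x e0 h abx.
  by rewrite h// mulVKf// e0.
- rewrite (@eq_quasi_remainder _ (D y)).
    by rewrite quasi_deriv_m; exact: ae_eq_refl.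
  by move=> s; rewrite -ltnS prednK// => sm; rewrite quasi_deriv_lt.
Qed.

Let quasi_remainder_eq_in Y Y' k : (forall s, (s <= k)%N -> {in `[a, b], Y s =1 Y' s}) ->
  ae_eq mu `[a, b]%classic (quasi_remainder Y k) (quasi_remainder Y' k).
Proof.
move=> YY'; apply: ae_itv_oo_cc; apply: aeW => x; rewrite /= in_itv /= => axb.
have xab : x \in `[a, b] by rewrite in_itv /=; case/andP: axb => /ltW -> /ltW ->.
rewrite /quasi_remainder (eq_cderiv axb (YY' k (leqnn k))); congr (_ - _).
by apply: eq_bigr => s _; rewrite YY'// -ltnS.
Qed.

(** Dividing by the superdiagonal entry determines each component from the preceding ones almost
    everywhere, hence on [[a, b]] by continuity. It makes the operators single-valued and lets
    boundary values be read off from a class in [L2]. *)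
Lemma quasi_system_uniq Y Y' F F' : quasi_system Y F -> quasi_system Y' F' ->
  {in `[a, b], Y 0%N =1 Y' 0%N} ->
  (forall k, (k < m)%N -> {in `[a, b], Y k =1 Y' k}) /\ ae_eq mu `[a, b]%classic F F'.
Proof.
move=> [Yac YE FE] [Y'ac Y'E F'E] Y0.
have YY' k : (k < m)%N -> forall s, (s <= k)%N -> {in `[a, b], Y s =1 Y' s}.
  elim: k => [|k IH] km s; first by rewrite leqn0 => /eqP ->.
  rewrite leq_eqVlt => /predU1P[->|]; last by rewrite ltnS; exact: IH (ltnW km) _.
  apply: abs_continuous_ae_eq => //; [exact: Yac|exact: Y'ac|].
  have rE := quasi_remainder_eq_in (IH (ltnW km)).
  have h : {ae mu, forall x, `[a, b]%classic x ->
      entry A k k.+1 x * Y k.+1 x = entry A k k.+1 x * Y' k.+1 x}.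
    by apply: filterS3 (YE k km) (Y'E k km) rE => x e1 e2 e3 abx; rewrite e1// e2// e3.
  by apply: filterS2 h (entry_neq0 km) => x e1 e2 abx; apply: (mulfI (e2 abx)); exact: e1.
split=> [k km|]; first exact: YY' km k (leqnn k).
have m1 : (m.-1 < m)%N by rewrite prednK.
have rE := quasi_remainder_eq_in (YY' _ m1).
by apply: filterS3 FE F'E rE => x e1 e2 e3 abx; rewrite e1// e2// e3.
Qed.

(** Converse to [quasi_system_quasi_deriv]. It recognizes linear combinations and conjugates of
    quasi-derivatives as quasi-derivatives again, which the recursive choice does not show. *)
Lemma quasi_system_realized Y F y : quasi_system Y F -> {in `[a, b], y =1 Y 0%N} ->
  [/\ qd_dom a b A y, (forall k, (k < m)%N -> {in `[a, b], quasi_deriv a b A k y =1 Y k})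
    & ae_eq mu `[a, b]%classic (quasi_deriv a b A m y) F].
Proof.
move=> [Yac YE FE] yY.
have DY k : (k < m)%N -> forall s, (s <= k)%N ->
    abs_continuous a b (D y s) /\ {in `[a, b], D y s =1 Y s}.
  elim: k => [|k IH] km s.
    rewrite leqn0 => /eqP ->; split=> //; apply: eq_abs_continuous (Yac _ m_gt0) => x xab.
    by rewrite -yY.
  rewrite leq_eqVlt => /predU1P[->|]; last by rewrite ltnS; exact: IH (ltnW km) _.
  rewrite D_S; apply: ac_representativeP; first exact: Yac.
  have rE := quasi_remainder_eq_in (fun s sk => (IH (ltnW km) s sk).2).
  apply: filterS3 rE (YE k km) (entry_neq0 km) => x e1 e2 e3 abx.
  by rewrite e1// -e2// mulKf// e3.
have DY' k (km : (k < m)%N) := DY k km k (leqnn k).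
split.
- by move=> k km; rewrite quasi_deriv_lt//; exact: (DY' k km).1.
- by move=> k km; rewrite quasi_deriv_lt//; exact: (DY' k km).2.
have m1 : (m.-1 < m)%N by rewrite prednK.
have rE := quasi_remainder_eq_in (fun s sk => (DY _ m1 s sk).2).
by rewrite quasi_deriv_m; apply: filterS2 FE rE => x e1 e2 abx; rewrite e1// e2.
Qed.

Let Y_derivable Y k : abs_continuous a b (Y k) -> {ae mu, forall x, `[a, b]%classic x ->
    derivable (fun t => Re (Y k t)) x 1 /\ derivable (fun t => Im (Y k t)) x 1}.
Proof. exact: abs_continuous_derivable. Qed.

Let quasi_remainder_lin c Y Y' k : abs_continuous a b (Y k) -> abs_continuous a b (Y' k) ->
  ae_eq mu `[a, b]%classic (quasi_remainder (fun k x => c * Y k x + Y' k x) k)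
    (fun x => c * quasi_remainder Y k x + quasi_remainder Y' k x).
Proof.
move=> Yac Y'ac.
apply: filterS2 (Y_derivable Yac) (Y_derivable Y'ac) => x d1 d2 abx.
have [d11 d12] := d1 abx; have [d21 d22] := d2 abx.
rewrite /quasi_remainder cderiv_lin// mulrBr addrACA; congr (_ + _).
rewrite mulr_sumr -opprD -big_split /=; congr (- _).
by apply: eq_bigr => s _; ring.
Qed.

Lemma quasi_system_lin c Y Y' F F' : quasi_system Y F -> quasi_system Y' F' ->
  quasi_system (fun k x => c * Y k x + Y' k x) (fun x => c * F x + F' x).
Proof.
move=> [Yac YE FE] [Y'ac Y'E F'E]; split.
- by move=> k km; apply: abs_continuous_lin => //; [exact: Yac|exact: Y'ac].
- move=> k km.
  have rl := quasi_remainder_lin c (Yac _ (ltnW km)) (Y'ac _ (ltnW km)).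
  apply: filterS3 rl (YE k km) (Y'E k km) => x e1 e2 e3 abx.
  by rewrite e1// -e2// -e3//; ring.
have m1 : (m.-1 < m)%N by rewrite prednK.
have rl := quasi_remainder_lin c (Yac _ m1) (Y'ac _ m1).
by apply: filterS3 rl FE F'E => x e1 e2 e3 abx; rewrite e1// e2// e3.
Qed.

Let quasi_remainder_conj Y k : abs_continuous a b (Y k) ->
  ae_eq mu `[a, b]%classic (quasi_remainder (fun k x => conjc (Y k x)) k)
    (fun x => conjc (quasi_remainder Y k x)).
Proof.
move=> Yac.
have er : {ae mu, forall x, forall s : 'I_k.+1, `[a, b]%classic x ->
    conjc (entry A k s x) = entry A k s x}.
  by apply: filter_forall => s; exact: entry_real.
apply: filterS2 (Y_derivable Yac) er => x d e abx.
have [_ d2] := d abx.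
rewrite /quasi_remainder cderiv_conj// rmorphB rmorph_sum /=; congr (_ - _).
by apply: eq_bigr => s _; rewrite rmorphM /= e.
Qed.

Lemma quasi_system_conj Y F : quasi_system Y F ->
  quasi_system (fun k x => conjc (Y k x)) (fun x => conjc (F x)).
Proof.
move=> [Yac YE FE]; split.
- by move=> k km; apply: abs_continuous_conj => //; exact: Yac.
- move=> k km; have rc := quasi_remainder_conj (Yac _ (ltnW km)).
  apply: filterS3 rc (YE k km) (entry_real k k.+1) => x e1 e2 e3 abx.
  by rewrite e1// -e2// rmorphM /= e3.
have m1 : (m.-1 < m)%N by rewrite prednK.
have rc := quasi_remainder_conj (Yac _ m1).
by apply: filterS2 rc FE => x e1 e2 abx; rewrite e1// e2.
Qed.

Lemma quasi_system0 : quasi_system (fun _ _ => 0) (fun=> 0).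
Proof.
have ac0 : abs_continuous a b (fun=> 0 : R[i]).
  apply/abs_continuousP => //; exists (fun=> 0), (fun=> 0).
  by split; apply: eq_primitive (primitive0 a b).
have r0 k : quasi_remainder (fun _ _ => 0) k = fun=> 0.
  apply/funext => x; rewrite /quasi_remainder big1 ?subr0 => [|s _]; last by rewrite mulr0.
  by rewrite /cderiv /= derive1_cst.
split=> [//|k km|].
  by apply: aeW => x _; rewrite r0 mulr0.
by apply: aeW => x _; rewrite r0.
Qed.

Lemma quasi_deriv_measurable y : qd_dom a b A y ->
  cmeasurable `[a, b]%classic (quasi_deriv a b A m y).
Proof.
move=> ydom; rewrite quasi_deriv_m.
have Dac k : (k < m)%N -> abs_continuous a b (D y k).
  by move=> km; rewrite -quasi_deriv_lt//; exact: ydom.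
have m1 : (m.-1 < m)%N by rewrite prednK.
have -> : quasi_remainder (D y) m.-1 = fun x => cderiv (D y m.-1) x +
    (-1) * \sum_(s < m.-1.+1) entry A m.-1 s x * D y s x.
  by apply/funext => x; rewrite mulN1r.
apply: cmeasurableD; first exact: cderiv_measurable (Dac _ m1).
apply: cmeasurableM; first exact: cmeasurable_cst.
apply: cmeasurable_sum => s; apply: cmeasurableM; first exact: entry_measurable.
apply: (abs_continuous_measurable ab); apply: Dac; rewrite -[X in (_ < X)%N](prednK m_gt0).
exact: ltn_ord.
Qed.

(** A common form for all four domains: [P] is trivial for [L_max], asks for zero values for
    [L_min], and is a [boundary_condition] for [L_sub] and [L_sup]. *)
Definition boundary_domain (P : (nat -> R[i]) -> (nat -> R[i]) -> Prop) : set (R -> R[i]) :=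
  [set y | max_dom a b A y /\
    P (fun k => quasi_deriv a b A k y a) (fun k => quasi_deriv a b A k y b)].

(** The sequences are indexed by all of [nat], but terms from index [m] on are not boundary values,
    and [P] must not depend on them. *)
Definition boundary_local (P : (nat -> R[i]) -> (nat -> R[i]) -> Prop) :=
  forall u u' v v', (forall k, (k < m)%N -> u k = u' k) ->
    (forall k, (k < m)%N -> v k = v' k) -> P u v -> P u' v'.

Lemma boundary_domain_system P Y F : boundary_local P -> quasi_system Y F -> L2_fun a b F ->
  P (fun k => Y k a) (fun k => Y k b) ->
  boundary_domain P (Y 0%N) /\ ae_eq mu `[a, b]%classic (quasi_deriv a b A m (Y 0%N)) F.
Proof.
move=> locP YF LF PY.
have [Ydom YE FE] := quasi_system_realized YF (fun x _ => erefl).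
have aab : a \in `[a, b] by rewrite in_itv /= lexx ltW.
have bab : b \in `[a, b] by rewrite in_itv /= lexx ltW.
split=> //; split.
  by split=> //; apply: L2_fun_ae_eq LF => //; exact: quasi_deriv_measurable.
by apply: locP PY => k km; rewrite YE.
Qed.

End QuasiDerivatives.

(** * Real operators *)

Section RealMaximalOperators.
Context {R : rcfType} {H : lmodType R[i]} (ip : H -> H -> R[i]) (J : H -> H).
Implicit Types (S T : set (H * H)) (u v w : H).
Local Notation Re := complex.Re.
Local Notation Im := complex.Im.

Hypothesis ip_linear : forall c u v w, ip (c *: u + v) w = c * ip u w + ip v w.
Hypothesis ip_conj : forall u v, ip v u = conjc (ip u v).
Hypothesis ip_ge0 : forall u, 0 <= Re (ip u u).
Hypothesis ip_def : forall u, Re (ip u u) = 0 -> u = 0.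
Hypothesis ip_J : forall u v, ip (J u) (J v) = conjc (ip u v).
Hypothesis JK : involutive J.

Let ip_linear_r c u v w : ip w (c *: u + v) = conjc c * ip w u + ip w v.
Proof. by rewrite ip_conj ip_linear rmorphD rmorphM /= -!ip_conj. Qed.

Let ip0l u : ip 0 u = 0.
Proof.
have := ip_linear 1 0 0 u; rewrite scaler0 addr0 mul1r => /eqP.
by rewrite -subr_eq0 opprD addrA subrr sub0r oppr_eq0 => /eqP.
Qed.

Let ip0r u : ip u 0 = 0.
Proof. by rewrite ip_conj ip0l conjc0. Qed.

(* Pythagoras: a vector orthogonal to a dense set is at distance at least its
   own norm from each element of that set. *)
Let dense_orthogonal T w : densely_defined ip T ->
  (forall f, op_dom T f -> ip f w = 0) -> w = 0.
Proof.
move=> dT Tw; apply: ip_def; apply/eqP; rewrite eq_le ip_ge0 andbT leNgt; apply/negP => w0.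
have nw0 : 0 < ip_norm ip w by rewrite /ip_norm sqrtr_gt0.
have [f Tf] := dT w _ nw0; rewrite ltNge => /negP; apply.
rewrite /ip_norm ler_sqrt//.
have -> : w - f = (-1) *: f + w by rewrite scaleN1r addrC.
rewrite ip_linear_r !ip_linear (Tw _ Tf) (ip_conj f w) (Tw _ Tf) conjc0 addr0 mulr0 add0r.
rewrite mulrA raddfD /= lerDr.
by rewrite (_ : conjc (-1) * -1 = 1 :> R[i]) ?mul1r ?ip_ge0// rmorphN1 mulrNN mulr1.
Qed.

(* The case [s = 1] concerns dissipative and [s = -1] accumulative operators. *)
Lemma real_maximal_self_adjoint (s : R) T : s != 0 ->
  linear_operator T -> densely_defined ip T ->
  (forall f g, T (f, g) -> T (J f, J g)) ->
  (forall f g, T (f, g) -> 0 <= s * Im (ip g f)) ->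
  (forall S, linear_operator S -> densely_defined ip S ->
    (forall f g, S (f, g) -> 0 <= s * Im (ip g f)) -> T `<=` S -> S = T) ->
  self_adjoint ip T.
Proof.
move=> s0 linT dT TJ Tpos Tmax; have [T0 Tlin Tfun] := linT.
have Treal f g : T (f, g) -> Im (ip g f) = 0.
  move=> Tfg; have h1 := Tpos _ _ Tfg; have := Tpos _ _ (TJ _ _ Tfg).
  rewrite ip_J; case: (ip g f) h1 => p q /= h1 h2.
  by apply: (mulfI s0); apply/eqP; rewrite mulr0 eq_le h1 andbT -oppr_ge0 -mulrN.
(* Polarization: realness of the quadratic form at [c *: f1 + f2], for [c = 1] and [c = 'i],
   compares the real and imaginary parts. *)
have Tsym f1 g1 f2 g2 : T (f1, g1) -> T (f2, g2) -> ip g1 f2 = ip f1 g2.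
  move=> T1 T2.
  have expand c : Im (c * ip g1 f2 + conjc c * ip g2 f1) = 0.
    have := Treal _ _ (Tlin c _ _ _ _ T1 T2).
    rewrite ip_linear !ip_linear_r.
    have /(_ _ _ T1) h1 := Treal; have /(_ _ _ T2) h2 := Treal.
    move: h1 h2; case: c (ip g1 f1) (ip g2 f2) (ip g1 f2) (ip g2 f1) =>
      [? ?] [? ?] [? ?] [? ?] [? ?] /= -> -> <-; ring.
  have := expand 1; have := expand 'i%C; rewrite (ip_conj g2 f1).
  case: (ip g1 f2) (ip g2 f1) => [p q] [p' q'] /= h1 h2.
  by congr (_ +i* _); lra.
split=> //; apply/seteqP; split=> [[h k] /= hk|[h k] Thk f g Tfg /=]; last exact: Tsym.
have main h' k' : (forall f g, T (f, g) -> ip g h' = ip f k') ->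
    0 <= s * Im (ip k' h') -> T (h', k').
  move=> {hk} {h k} adj pos; pose S : set (H * H) :=
    [set p | exists c f g, T (f, g) /\ p = (c *: h' + f, c *: k' + g)].
  have TS : T `<=` S.
    by move=> [f g] Tfg; exists 0, f, g; rewrite !scale0r !add0r.
  suff <- : S = T by exists 1, 0, 0; rewrite !scale1r !addr0.
  (* This makes [S] single-valued: if [c *: h' + f = 0], then [c *: k' + g] is orthogonal to the
     domain of [T], which is dense. *)
  have S0 c f g : T (f, g) -> c *: h' + f = 0 -> c *: k' + g = 0.
    move=> Tfg e0; apply: (dense_orthogonal dT) => f' [g' Tfg'].
    by rewrite ip_linear_r -(adj _ _ Tfg') -(Tsym _ _ _ _ Tfg' Tfg) -ip_linear_r e0 ip0r.
  apply: Tmax => //.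
  - split; first exact: TS.
      move=> c _ _ _ _ [c1 [f1 [g1 [T1 [-> ->]]]]] [c2 [f2 [g2 [T2 [-> ->]]]]].
      exists (c * c1 + c2), (c *: f1 + f2), (c *: g1 + g2); split; first exact: Tlin.
      by rewrite !scalerDr !scalerDl !scalerA; congr (_, _); rewrite addrACA.
    move=> f0 _ _ [c1 [f1 [g1 [T1 [-> ->]]]]] [c2 [f2 [g2 [T2 [e12 ->]]]]].
    have /(S0 (- c2 + c1)) := Tlin (-1) _ _ _ _ T2 T1.
    have rearr (p q r t : H) c c' : (- c' + c) *: p + (-1 *: t + q) = (c *: p + q) - (c' *: p + t).
      by rewrite scalerDl scaleNr scaleN1r addrACA addrC -opprD.
    rewrite !rearr// e12 subrr => /(_ erefl) /eqP; rewrite subr_eq0 => /eqP //.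
  - move=> f e e0; have [g [g' Tg] lt] := dT f e e0; exists g => //.
    by exists g'; exact: TS.
  (* The cross terms are conjugate to each other by the adjoint relation and [ip g f] is real, so
     what remains is the squared modulus of [c] times [s * Im (ip k' h')]. *)
  move=> _ _ [c [f [g [Tfg [-> ->]]]]].
  rewrite ip_linear !ip_linear_r (adj _ _ Tfg) (ip_conj k' f).
  move: (Treal _ _ Tfg) pos.
  case: c (ip k' h') (ip k' f) (ip g f) => [p q] [u v] [u1 v1] [u2 v2] /= -> pos.
  rewrite (_ : s * _ = (p ^+ 2 + q ^+ 2) * (s * v)); last by ring.
  by rewrite mulr_ge0// addr_ge0 ?sqr_ge0.
have [pos|neg] := leP 0 (s * Im (ip k h)); first exact: main.
rewrite -(JK h) -(JK k); apply: (TJ); apply: main.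
  move=> f g Tfg; rewrite -{1}(JK g) -{1}(JK f) !ip_J; congr conjc.
  exact: hk (TJ _ _ Tfg).
rewrite ip_J; case: (ip k h) neg => p q /= neg; rewrite mulrN oppr_ge0; exact: ltW.
Qed.

End RealMaximalOperators.

(** * Inner product and conjugation on classes of square-integrable functions *)

Section L2Classes.
Context {R : realType} (a b : R).
Implicit Types (f g : R -> R[i]) (u v w : L2 a b).

Local Notation mu := (@lebesgue_measure R).
Local Notation Re := complex.Re.
Local Notation Im := complex.Im.

Lemma L2_class_exists f : L2_fun a b f -> exists u, L2_class u f.
Proof.
move=> Lf; have Lf' : (f : R -> R[i]^o) \in L2_pred a b by apply/asboolP.
exists (\pi_(L2 a b)%qT (MkL2func Lf')); rewrite /L2_class /L2_fun_of.
by apply/(L2_piP _ (MkL2func Lf')); rewrite reprK.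
Qed.

Lemma L2_class_self u : L2_class u (L2_fun_of u).
Proof. exact: ae_eq_refl. Qed.

Lemma L2_fun_of_L2 u : L2_fun a b (L2_fun_of u).
Proof. by apply/asboolP; exact: (L2func_in (repr u)). Qed.

Lemma L2_class_ae u f g : L2_class u f -> ae_eq mu `[a, b]%classic f g -> L2_class u g.
Proof. by move=> h1 h2; apply: filterS2 h1 h2 => x e1 e2 abx; rewrite e1// e2. Qed.

Lemma L2_class_ae_eq u f g : L2_class u f -> L2_class u g -> ae_eq mu `[a, b]%classic f g.
Proof. by move=> h1 h2; apply: filterS2 h1 h2 => x e1 e2 abx; rewrite -e1// e2. Qed.

Lemma L2_class_inj u v f : L2_class u f -> L2_class v f -> u = v.
Proof.
move=> uf vf; rewrite -[u]reprK -[v]reprK; apply/L2_piP.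
by apply: filterS2 uf vf => x e1 e2 abx; rewrite [LHS]e1// [RHS]e2.
Qed.

Lemma L2_class_lin c u v f g : L2_class u f -> L2_class v g ->
  L2_class (c *: u + v) (fun x => c * f x + g x).
Proof.
move=> uf vg.
have -> : c *: u + v = \pi_(L2 a b)%qT (c *: repr u + repr v).
  by rewrite L2_piD reprK.
have : ae_eq mu `[a, b]%classic (repr (\pi_(L2 a b)%qT (c *: repr u + repr v)) : R -> R[i])
    (c *: repr u + repr v : L2func a b).
  by apply/L2_piP; rewrite reprK.
move=> h; apply: filterS3 h uf vg => x e1 e2 e3 abx; rewrite /L2_fun_of e1//.
by rewrite -e2// -e3.
Qed.

Lemma L2_class_conj u f : L2_class u f -> L2_class (L2_conj u) (fun x => conjc (f x)).
Proof.
move=> uf.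
have : ae_eq mu `[a, b]%classic (repr (L2_conj u) : R -> R[i]) (MkL2func (L2_conj_subproof (repr u))).
  by apply/L2_piP; rewrite reprK.
move=> h; apply: filterS2 h uf => x e1 e2 abx; rewrite /L2_fun_of e1//=.
by rewrite -e2.
Qed.

Lemma L2_conjK : involutive (@L2_conj R a b).
Proof.
move=> u; apply: (@L2_class_inj _ _ (fun x => conjc (conjc (L2_fun_of u x)))).
  by do 2 apply: L2_class_conj; exact: L2_class_self.
apply: L2_class_ae (L2_class_self u) _; apply: aeW => x _; by rewrite conjcK.
Qed.

Lemma L2_fun_prod f g : L2_fun a b f -> L2_fun a b g ->
  L1_fun a b (fun x => f x * conjc (g x)).
Proof.
move=> [f1 f2 fi] [g1 g2 gi].
have dom : mu.-integrable `[a, b] (fun x => (Re (f x) ^+ 2 + Im (f x) ^+ 2)%:E +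
    (Re (g x) ^+ 2 + Im (g x) ^+ 2)%:E)%E by exact: integrableD.
have cg : cmeasurable `[a, b]%classic (fun x => conjc (g x)).
  split.
    have -> : (fun x => Re (conjc (g x))) = (fun x => Re (g x)) by apply/funext => x; case: (g x).
    by [].
  have -> : (fun x => Im (conjc (g x))) = (fun x => - Im (g x)).
    by apply/funext => x; case: (g x).
  exact: measurable_funN.
have [m1 m2] := cmeasurableM (conj f1 f2 : cmeasurable _ f) cg.
split; apply: (le_integrable _ _ _ dom) => //; try exact/measurable_EFinP.
  move=> x _; rewrite -EFinD /= lee_fin [leRHS]ger0_norm ?addr_ge0 ?sqr_ge0// ler_norml.
  case: (f x) (g x) => [p q] [p' q'] /=.
  have := sqr_ge0 (p - p'); have := sqr_ge0 (q - q').
  have := sqr_ge0 (p + p'); have := sqr_ge0 (q + q').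
  have := sqr_ge0 p; have := sqr_ge0 q; have := sqr_ge0 p'; have := sqr_ge0 q'.
  by move=> *; apply/andP; split; nra.
move=> x _; rewrite -EFinD /= lee_fin [leRHS]ger0_norm ?addr_ge0 ?sqr_ge0// ler_norml.
case: (f x) (g x) => [p q] [p' q'] /=.
have := sqr_ge0 (p - q'); have := sqr_ge0 (q - p').
have := sqr_ge0 (p + q'); have := sqr_ge0 (q + p').
have := sqr_ge0 p; have := sqr_ge0 q; have := sqr_ge0 p'; have := sqr_ge0 q'.
by move=> *; apply/andP; split; nra.
Qed.

Lemma cintegral_ae_eq f g : L1_fun a b f -> L1_fun a b g ->
  ae_eq mu `[a, b]%classic f g -> cintegral a b f = cintegral a b g.
Proof.
move=> [f1 f2] [g1 g2] fg; rewrite /cintegral /Rintegral; congr (fine _ +i* fine _).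
  apply: ae_eq_integral => //; [exact: measurable_int f1|exact: measurable_int g1|].
  by apply: filterS fg => x h abx; rewrite h.
apply: ae_eq_integral => //; [exact: measurable_int f2|exact: measurable_int g2|].
by apply: filterS fg => x h abx; rewrite h.
Qed.

Lemma cintegral_lin c f g : L1_fun a b f -> L1_fun a b g ->
  cintegral a b (fun x => c * f x + g x) = c * cintegral a b f + cintegral a b g.
Proof.
move=> [f1 f2] [g1 g2].
have key (p q : R) (r s t : R -> R) : mu.-integrable `[a, b] (EFin \o r) ->
    mu.-integrable `[a, b] (EFin \o s) -> mu.-integrable `[a, b] (EFin \o t) ->
    \int[mu]_(x in `[a, b]) (p * r x + (q * s x + t x)) =
    p * \int[mu]_(x in `[a, b]) r x + (q * \int[mu]_(x in `[a, b]) s x +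
      \int[mu]_(x in `[a, b]) t x).
  move=> ir is' it.
  have iZ k z : mu.-integrable `[a, b] (EFin \o z) ->
      mu.-integrable `[a, b] (EFin \o (fun x => k * z x)).
    move=> iz; have : mu.-integrable `[a, b] (fun x => k%:E * (EFin \o z) x)%E.
      exact: integrableZl.
    exact: eq_integrable.
  have ist : mu.-integrable `[a, b] (EFin \o (fun x => q * s x + t x)).
    have : mu.-integrable `[a, b] (fun x => (q * s x)%:E + (t x)%:E)%E.
      by apply: integrableD => //; exact: iZ.
    exact: eq_integrable.
  by rewrite !RintegralD ?RintegralZl//; exact: iZ.
rewrite /cintegral.
have := key (Re c) (- Im c) _ _ _ f1 f2 g1; have := key (Re c) (Im c) _ _ _ f2 f1 g2.
move=> h2 h1; case: c h1 h2 => p q /= h1 h2; simpc; congr (_ +i* _).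
  transitivity (p * \int[mu]_(x in `[a, b]) Re (f x) + (- q * \int[mu]_(x in `[a, b]) Im (f x) +
      \int[mu]_(x in `[a, b]) Re (g x))); last by ring.
  rewrite -h1; apply: eq_Rintegral => x _.
  by case: (f x) (g x) => [? ?] [? ?] /=; ring.
transitivity (p * \int[mu]_(x in `[a, b]) Im (f x) + (q * \int[mu]_(x in `[a, b]) Re (f x) +
    \int[mu]_(x in `[a, b]) Im (g x))); last by ring.
rewrite -h2; apply: eq_Rintegral => x _.
by case: (f x) (g x) => [? ?] [? ?] /=; ring.
Qed.

Lemma cintegral_conj f : L1_fun a b f ->
  cintegral a b (fun x => conjc (f x)) = conjc (cintegral a b f).
Proof.
move=> [f1 f2]; rewrite /cintegral /=; congr (_ +i* _).
  by apply: eq_Rintegral => x _; case: (f x).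
rewrite -mulN1r -RintegralZl//; apply: eq_Rintegral => x _; by case: (f x) => ? ? /=; ring.
Qed.

(** Frees the inner product from the representatives fixed by [repr], which do not commute with sums
    or conjugation. *)
Lemma L2_ipE u v f g : L2_fun a b f -> L2_fun a b g -> L2_class u f -> L2_class v g ->
  L2_ip a b u v = cintegral a b (fun x => f x * conjc (g x)).
Proof.
move=> Lf Lg uf vg; apply: cintegral_ae_eq.
- by apply: L2_fun_prod; exact: L2_fun_of_L2.
- exact: L2_fun_prod.
- by apply: filterS2 uf vg => x e1 e2 abx; rewrite e1// e2.
Qed.

Lemma L2_ip_linear c u v w :
  L2_ip a b (c *: u + v) w = c * L2_ip a b u w + L2_ip a b v w.
Proof.
have Lu := L2_fun_of_L2 u; have Lv := L2_fun_of_L2 v; have Lw := L2_fun_of_L2 w.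
rewrite (L2_ipE (L2_fun_lin c Lu Lv) Lw (L2_class_lin c (L2_class_self u) (L2_class_self v))
  (L2_class_self w)) /L2_ip -cintegral_lin; [|exact: L2_fun_prod..].
congr cintegral; apply/funext => x; ring.
Qed.

Lemma L2_ip_conj u v : L2_ip a b v u = conjc (L2_ip a b u v).
Proof.
rewrite /L2_ip -cintegral_conj; last by apply: L2_fun_prod; exact: L2_fun_of_L2.
by congr cintegral; apply/funext => x; rewrite rmorphM /= conjcK mulrC.
Qed.

Lemma L2_ip_L2_conj u v : L2_ip a b (L2_conj u) (L2_conj v) = conjc (L2_ip a b u v).
Proof.
have Lu := L2_fun_of_L2 u; have Lv := L2_fun_of_L2 v.
rewrite (L2_ipE (L2_fun_conj Lu) (L2_fun_conj Lv) (L2_class_conj (L2_class_self u))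
  (L2_class_conj (L2_class_self v))).
rewrite /L2_ip -cintegral_conj; last exact: L2_fun_prod.
by congr cintegral; apply/funext => x; rewrite rmorphM.
Qed.

Let Re_normSq (z : R[i]) : Re (z * conjc z) = Re z ^+ 2 + Im z ^+ 2.
Proof. by case: z => p q /=; ring. Qed.

Lemma L2_ip_ge0 u : 0 <= Re (L2_ip a b u u).
Proof.
apply: Rintegral_ge0 => x _; by rewrite Re_normSq addr_ge0 ?sqr_ge0.
Qed.

Lemma L2_ip_eq0 u : Re (L2_ip a b u u) = 0 -> u = 0.
Proof.
rewrite /L2_ip /cintegral /= => u0.
have [i1 _] := L2_fun_prod (L2_fun_of_L2 u) (L2_fun_of_L2 u).
have /(ae_eq_integral_abs mu (measurable_itv _)) :
    (\int[mu]_(x in `[a, b]) `|(Re (L2_fun_of u x * conjc (L2_fun_of u x)))%:E|)%E = 0%E.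
  under eq_integral do rewrite gee0_abs ?lee_fin ?Re_normSq ?addr_ge0 ?sqr_ge0// -Re_normSq.
  by rewrite -[LHS]fineK ?integrable_fin_num//; congr EFin.
move=> /(_ (measurable_int _ i1)) ae0.
have cu : L2_class u (fun=> 0).
  apply: filterS ae0 => x h abx; have := h abx; move=> [] /eqP.
  rewrite Re_normSq paddr_eq0 ?sqr_ge0// !sqrf_eq0 => /andP[/eqP p0 /eqP q0].
  by apply/eqP; rewrite eq_complex p0 q0 !eqxx.
apply: L2_class_inj cu _.
rewrite /L2_class.
have : ae_eq mu `[a, b]%classic (repr (0 : L2 a b) : R -> R[i]) (0 : L2func a b).
  apply/L2_piP; rewrite reprK; apply: (addrI (\pi_(L2 a b)%qT (0 : L2func a b))).
  by rewrite -L2_piD !addr0.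
by [].
Qed.

Lemma L2_real_max_self_adjoint (T : set (L2 a b * L2 a b)) : real_operator T ->
  max_dissipative (L2_ip a b) T \/ max_accumulative (L2_ip a b) T ->
  self_adjoint (L2_ip a b) T.
Proof.
have sa := real_maximal_self_adjoint L2_ip_linear L2_ip_conj L2_ip_ge0 L2_ip_eq0
  L2_ip_L2_conj L2_conjK.
move=> [Tlin TJ] [] [[_ Td Tpos] Tmax].
  apply: (sa 1) => //; first by move=> f g /Tpos; rewrite mul1r.
  move=> S Slin Sd Spos; apply: Tmax; split=> // f g /Spos; by rewrite mul1r.
apply: (sa (-1)) => //.
  by move=> f g /Tpos; rewrite mulN1r oppr_ge0.
by move=> S Slin Sd Spos; apply: Tmax; split=> // f g /Spos; rewrite mulN1r oppr_ge0.
Qed.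

End L2Classes.

(** * Boundary values *)

Section BoundaryRealization.
Context {R : realType} (a b : R) (m : nat) (A : R -> 'M[R[i]]_m).
Hypothesis ab : a < b.
Hypothesis m_gt0 : (0 < m)%N.
Hypothesis szA : shin_zettl a b A.
Hypothesis realA : real_entries a b A.
Implicit Types (Y : nat -> R -> R[i]) (F y : R -> R[i]).

Local Notation mu := (@lebesgue_measure R).
Local Notation Re := complex.Re.
Local Notation Im := complex.Im.

Let last_lt : (m.-1 < m)%N. Proof. by rewrite prednK. Qed.
Let l : 'I_m := Ordinal last_lt.

(** Entries beyond the superdiagonal vanish only almost everywhere in [A]; here they are zero
    everywhere, in accordance with [quasi_system], which never reads them. Taking real parts changes
    [A] only on a null set. *)
Let B (x : R) : 'M[R]_m := \matrix_(i, j) if (j < i.+2)%N then Re (A x i j) else 0.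

Let B_integrable i j : mu.-integrable `[a, b] (EFin \o (fun x => B x i j)).
Proof.
have [_ /(_ i j)[iA _] _] := szA.
case: (boolP (j < i.+2)%N) => ji.
  by apply: eq_integrable iA => // x _; rewrite /= mxE ji.
have : mu.-integrable `[a, b] (EFin \o (fun=> 0 : R)) by exact: integrable0.
by apply: eq_integrable => // x _; rewrite /= mxE (negbTE ji).
Qed.

Let B_eq0 (i j : 'I_m) : (i.+1 < j)%N -> {ae mu, forall x, `[a, b]%classic x -> B x i j = 0}.
Proof. by move=> ij; apply: aeW => x _; rewrite mxE ltnNge ij. Qed.

Let B_neq0 (i j : 'I_m) : j = i.+1 :> nat ->
  {ae mu, forall x, `[a, b]%classic x -> B x i j != 0}.
Proof.
move=> ji; have [_ _ /(_ i j ji) An0] := szA.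
apply: filterS2 An0 (realA i j) => x h1 h2 abx; rewrite mxE ji ltnS leqnn.
by move: (h1 abx) (h2 abx); case: (A x i j) => p q /= + q0; rewrite q0 eq_complex /= eqxx andbT.
Qed.

Let entry_ord (k s : 'I_m) x : entry A k s x = A x k s.
Proof. by rewrite /entry !valK. Qed.

(** The coefficient matrix is real, so the real and imaginary parts of the boundary data are two
    independent control problems. The control is the quasi-derivative of order [m]; being
    continuous, it is square-integrable. *)
Lemma boundary_values_realized (alpha beta : nat -> R[i]) : exists Y F,
  [/\ quasi_system a b A Y F, L2_fun a b F
    & forall k, (k < m)%N -> Y k a = alpha k /\ Y k b = beta k].
Proof.
have lm : l.+1 = m by rewrite /= prednK.
have [Yr [fr [frc Yrp Yra Yrb]]] := controllability ab lm B_integrable B_eq0 B_neq0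
  (fun i => Re (alpha i)) (fun i => Re (beta i)).
have [Yi [fi [fic Yip Yia Yib]]] := controllability ab lm B_integrable B_eq0 B_neq0
  (fun i => Im (alpha i)) (fun i => Im (beta i)).
pose Y k x := if insub k is Some i then Yr i x +i* Yi i x else 0 : R[i].
pose F x := fr x +i* fi x.
have YE (i : 'I_m) x : Y i x = Yr i x +i* Yi i x by rewrite /Y valK.
have YE' k (km : (k < m)%N) : Y k = fun x => Yr (Ordinal km) x +i* Yi (Ordinal km) x.
  by apply/funext => x; rewrite -(YE (Ordinal km)).
have Yac k : (k < m)%N -> abs_continuous a b (Y k).
  by move=> km; rewrite (YE' k km); exact: primitive_abs_continuous (Yrp _) (Yip _).
have FL2 : L2_fun a b F.
  have cint (g : R -> R) : {within `[a, b], continuous g} ->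
      mu.-integrable `[a, b] (EFin \o (fun x => g x * g x)).
    move=> gc; apply: continuous_integrable_mul => //.
    by apply: continuous_compact_integrable => //; exact: segment_compact.
  split; [exact: subspace_continuous_measurable_fun|exact: subspace_continuous_measurable_fun|].
  have : mu.-integrable `[a, b] (fun x => (fr x * fr x)%:E + (fi x * fi x)%:E)%E.
    by apply: integrableD => //; exact: cint.
  by apply: eq_integrable.
(* The [minn] treats all rows at once: the last row has no column [i.+1], and it alone receives the
   control. *)
have derivE (i : 'I_m) : ae_eq mu `[a, b]%classic (cderiv (Y i))
    (fun x => \sum_(s < minn m i.+2) entry A i s x * Y s x + (if i == l then F x else 0)).
  have dY := cderiv_primitive (f := Y i) ab
     (eq_primitive (fun x _ => congr1 (@complex.Re R) (esym (YE i x))) (fun _ _ => erefl) (Yrp i))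
     (eq_primitive (fun x _ => congr1 (@complex.Im R) (esym (YE i x))) (fun _ _ => erefl) (Yip i)).
  have rA : {ae mu, forall x, forall j, `[a, b]%classic x -> Im (A x i j) = 0}.
    by apply: filter_forall => j; exact: realA.
  apply: filterS2 dY rA => x h1 h2 abx; rewrite h1//.
  have -> : \sum_(s < minn m i.+2) entry A i s x * Y s x =
      \sum_(j < m) (B x i j)%:C * Y j x.
    rewrite (big_ord_widen m (fun s => entry A i s x * Y s x)) ?geq_minl//.
    rewrite big_mkcond /=; apply: eq_bigr => j _; rewrite leq_min ltn_ord /= mxE.
    case: ifP => ji; last by rewrite mul0r.
    rewrite entry_ord; congr (_ * _).
    by have := h2 j abx; case: (A x i j) => p q /= ->.
  have sumE (I : Type) (s : seq I) (p q : I -> R) :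
      \sum_(j <- s) (p j +i* q j) = (\sum_(j <- s) p j) +i* (\sum_(j <- s) q j).
    elim: s => [|j s IH]; first by rewrite !big_nil.
    by rewrite !big_cons IH; simpc.
  rewrite (eq_bigr (fun j => (B x i j * Yr j x) +i* (B x i j * Yi j x))) => [|j _]; last first.
    by rewrite YE; simpc.
  by rewrite sumE /F; case: (i == l); simpc; rewrite ?addr0.
have rem_sum k x c : cderiv (Y k) x = \sum_(s < k.+1) entry A k s x * Y s x + c ->
    c = quasi_remainder A Y k x.
  by move=> e; rewrite /quasi_remainder e addrC addKr.
exists Y, F; split=> //.
- split=> //.
  + move=> k km; have /= := derivE (Ordinal (ltnW km)).
    apply: filterS => x h abx; apply: rem_sum; rewrite h//.
    rewrite (minn_idPr km) big_ord_recr /= ifF ?addr0//.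
    by apply/negbTE; rewrite -val_eqE /= neq_ltn -ltnS prednK// km.
  + have /= := derivE l.
    apply: filterS => x h abx; apply: rem_sum; rewrite h// eqxx.
    have -> : minn m m.-1.+2 = m.-1.+1 by rewrite prednK//; exact/minn_idPl/leqnSn.
    by [].
- move=> k km; rewrite (YE' k km) Yra Yrb Yia Yib /=.
  by case: (alpha k) (beta k) => [? ?] [? ?].
Qed.

Variable P : (nat -> R[i]) -> (nat -> R[i]) -> Prop.
Hypothesis P_local : @boundary_local R m P.
Let T := qd_operator (a := a) (b := b) A (boundary_domain a b A P).

Let a_in : a \in `[a, b]. Proof. by rewrite in_itv /= lexx ltW. Qed.
Let b_in : b \in `[a, b]. Proof. by rewrite in_itv /= lexx ltW. Qed.

(** Describes the graph by arbitrary systems, so that later arguments combine and conjugate systems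
    and never touch [ac_representative]. *)
Lemma qd_operatorP p : T p <-> exists Y F,
  [/\ quasi_system a b A Y F, L2_fun a b F, P (fun k => Y k a) (fun k => Y k b)
    & L2_class p.1 (Y 0%N) /\ L2_class p.2 (fun x => 'i%C ^+ m * F x)].
Proof.
split=> [[y [[ydom yL2] yP] [p1 p2]]|[Y [F [YF FL2 YP [p1 p2]]]]].
  exists (fun k => quasi_deriv a b A k y), (quasi_deriv a b A m y); split=> //.
    exact: quasi_system_quasi_deriv.
  split=> //; apply: L2_class_ae p1 _; apply: aeW => x _.
  by rewrite /quasi_deriv m_gt0.
have [Ydom YE] := boundary_domain_system ab m_gt0 szA P_local YF FL2 YP.
exists (Y 0%N) => //; split=> //; apply: L2_class_ae p2 _.
by apply: filterS YE => x h abx; rewrite /qd_expr h.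
Qed.

(** The class of the conjugate of [f] determines its continuous representative, hence the whole
    system above it. Any witness of membership in the graph therefore has the conjugated boundary
    values. *)
Lemma qd_operator_conj_boundary Y F f g : quasi_system a b A Y F ->
  L2_class f (Y 0%N) -> T (L2_conj f, L2_conj g) ->
  P (fun k => conjc (Y k a)) (fun k => conjc (Y k b)).
Proof.
move=> YF fY /qd_operatorP[Y' [F' [Y'F' _ PY' [/= f' _]]]].
have cYF := quasi_system_conj ab m_gt0 realA YF.
have [Yac _ _] := cYF; have [Y'ac _ _] := Y'F'.
have Y0 := abs_continuous_ae_eq ab (Y'ac _ m_gt0) (Yac _ m_gt0)
  (L2_class_ae_eq f' (L2_class_conj fY)).
have [YY' _] := quasi_system_uniq ab m_gt0 szA Y'F' cYF Y0.
by apply: P_local PY' => k km; rewrite YY'.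
Qed.

Hypothesis P0 : P (fun=> 0) (fun=> 0).
Hypothesis P_lin : forall (c : R[i]) u v u' v', P u v -> P u' v' ->
  P (fun k => c * u k + u' k) (fun k => c * v k + v' k).

Lemma qd_operator_linear : linear_operator T.
Proof.
split.
- apply/qd_operatorP; exists (fun _ _ => 0), (fun=> 0); split=> //.
  + exact: quasi_system0.
  + exact: L2_fun_cst0.
  (* The zero of [L2] is reached as [(-1) *: u + u], so that [L2_class_lin] yields its class. *)
  have [u u0] := L2_class_exists (L2_fun_cst0 a b).
  have := L2_class_lin (-1) u0 u0; rewrite scaleN1r addNr => h.
  by split; apply: L2_class_ae h _; apply: aeW => x _; rewrite !mulr0 addr0.
- move=> c f1 g1 f2 g2 /qd_operatorP[Y1 [F1 [YF1 FL1 P1 [/= f1Y g1F]]]].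
  move=> /qd_operatorP[Y2 [F2 [YF2 FL2 P2 [/= f2Y g2F]]]].
  apply/qd_operatorP; exists (fun k x => c * Y1 k x + Y2 k x), (fun x => c * F1 x + F2 x).
  split.
  + exact: quasi_system_lin.
  + exact: L2_fun_lin.
  + exact: P_lin.
  split; first exact: L2_class_lin.
  apply: L2_class_ae (L2_class_lin c g1F g2F) _; apply: aeW => x _; ring.
- move=> f g1 g2 /qd_operatorP[Y1 [F1 [YF1 _ _ [/= f1Y g1F]]]].
  move=> /qd_operatorP[Y2 [F2 [YF2 _ _ [/= f2Y g2F]]]].
  have [Y1ac _ _] := YF1; have [Y2ac _ _] := YF2.
  have Y0 := abs_continuous_ae_eq ab (Y1ac _ m_gt0) (Y2ac _ m_gt0) (L2_class_ae_eq f1Y f2Y).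
  have [_ FF] := quasi_system_uniq ab m_gt0 szA YF1 YF2 Y0.
  apply: L2_class_inj g1F (L2_class_ae g2F _).
  by apply: filterS FF => x h abx; rewrite h.
Qed.

Hypothesis i_real : conjc ('i%C ^+ m) = 'i%C ^+ m :> R[i].
Hypothesis P_conj : forall u v, P u v -> P (fun k => conjc (u k)) (fun k => conjc (v k)).

Lemma qd_operator_real : real_operator T.
Proof.
split; first exact: qd_operator_linear.
move=> f g /qd_operatorP[Y [F [YF FL2 PY [/= fY gF]]]]; apply/qd_operatorP.
exists (fun k x => conjc (Y k x)), (fun x => conjc (F x)); split.
- exact: quasi_system_conj.
- exact: L2_fun_conj.
- exact: P_conj.
split; first exact: L2_class_conj.
apply: L2_class_ae (L2_class_conj gF) _; apply: aeW => x _.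
by rewrite rmorphM /= i_real.
Qed.

End BoundaryRealization.

(** * Matrix boundary conditions and conjugation *)

Section BoundaryConditions.
Context {R : realType} {n : nat}.
Implicit Types (K M : 'M[R[i]]_(n + n)) (u v : nat -> R[i]).

(** [Gamma1] and, below, [Gamma2] as functions of the boundary values alone, so that they can be
    studied apart from any differential expression. *)
Definition boundary1 u v : 'cV[R[i]]_(n + n) :=
  col_mx (\col_(k < n) ('i%C ^+ (n + n) * (-1) ^+ k.+1 * u (n + n - k.+1)%N))
         (\col_(k < n) ('i%C ^+ (n + n) * (-1) ^+ k * v (n + n - k.+1)%N)).

Definition boundary2 u v : 'cV[R[i]]_(n + n) :=
  col_mx (\col_(k < n) u k) (\col_(k < n) v k).

(** The parameter [s] is ['i] for [L_sub] and [- 'i] for [L_sup]; what matters is [conjc s = - s]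
    and, for one direction, [s != 0]. *)
Definition boundary_condition (s : R[i]) K u v : Prop :=
  (K - 1%:M) *m boundary1 u v + s *: ((K + 1%:M) *m boundary2 u v) = 0.

Lemma iX_even : 'i%C ^+ (n + n) = (-1) ^+ n :> R[i].
Proof. by rewrite addnn -muln2 mulnC exprM sqr_i. Qed.

Lemma iX_even_real : conjc ('i%C ^+ (n + n)) = 'i%C ^+ (n + n) :> R[i].
Proof. by rewrite iX_even rmorphXn rmorphN1. Qed.

Let sub_lt (k : 'I_n) : (n + n - k.+1 < n + n)%N.
Proof. by rewrite ltn_subrL addn_gt0 (leq_trans _ (ltn_ord k)). Qed.

Let lt_add (k : 'I_n) : (k < n + n)%N.
Proof. exact: leq_trans (ltn_ord k) (leq_addr _ _). Qed.

Lemma boundary_condition_local s K : @boundary_local R (n + n) (boundary_condition s K).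
Proof.
move=> u u' v v' uu' vv'; rewrite /boundary_condition.
have -> : boundary1 u v = boundary1 u' v'.
  by congr col_mx; apply/colP => k; rewrite !mxE ?uu' ?vv'.
have -> // : boundary2 u v = boundary2 u' v'.
by congr col_mx; apply/colP => k; rewrite !mxE ?uu' ?vv'.
Qed.

Lemma boundary1_lin c u v u' v' :
  boundary1 (fun k => c * u k + u' k) (fun k => c * v k + v' k) =
  c *: boundary1 u v + boundary1 u' v'.
Proof.
rewrite /boundary1 scale_col_mx add_col_mx.
by congr col_mx; apply/colP => k; rewrite !mxE; ring.
Qed.

Lemma boundary2_lin c u v u' v' :
  boundary2 (fun k => c * u k + u' k) (fun k => c * v k + v' k) =
  c *: boundary2 u v + boundary2 u' v'.
Proof.
rewrite /boundary2 scale_col_mx add_col_mx.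
by congr col_mx; apply/colP => k; rewrite !mxE.
Qed.

Lemma boundary1_conj u v :
  boundary1 (fun k => conjc (u k)) (fun k => conjc (v k)) = map_mx conjc (boundary1 u v).
Proof.
rewrite /boundary1 map_col_mx; congr col_mx; apply/colP => k;
  by rewrite !mxE !rmorphM /= iX_even_real rmorphXn rmorphN1.
Qed.

Lemma boundary2_conj u v :
  boundary2 (fun k => conjc (u k)) (fun k => conjc (v k)) = map_mx conjc (boundary2 u v).
Proof.
by rewrite /boundary2 map_col_mx; congr col_mx; apply/colP => k; rewrite !mxE.
Qed.

Lemma boundary_condition0 s K : boundary_condition s K (fun=> 0) (fun=> 0).
Proof.
have b10 : boundary1 (fun=> 0) (fun=> 0) = 0.
  by apply/colP => j; rewrite mxE; case: (fintype.split j) => k; rewrite !mxE mulr0.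
have b20 : boundary2 (fun=> 0) (fun=> 0) = 0.
  by apply/colP => j; rewrite mxE; case: (fintype.split j) => k; rewrite !mxE.
by rewrite /boundary_condition b10 b20 !mulmx0 scaler0 addr0.
Qed.

Lemma boundary_condition_lin s K c u v u' v' :
  boundary_condition s K u v -> boundary_condition s K u' v' ->
  boundary_condition s K (fun k => c * u k + u' k) (fun k => c * v k + v' k).
Proof.
rewrite /boundary_condition boundary1_lin boundary2_lin => e1 e2.
rewrite !mulmxDr -!scalemxAr scalerDr scalerA [s * c]mulrC -scalerA addrACA.
by rewrite -scalerDr e1 e2 scaler0 addr0.
Qed.

(** The two maps read disjoint indices: [boundary2] those below [n], [boundary1] those from [n] to
    [n + n - 1] in reverse order. The coefficients of [boundary1] are signs, hence their own
    inverses. *)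
Lemma boundary_values_exist (w1 w2 : 'cV[R[i]]_(n + n)) :
  exists u v, boundary1 u v = w1 /\ boundary2 u v = w2.
Proof.
pose get (w : 'cV[R[i]]_n) (k : nat) : R[i] := if insub k is Some i then w i 0 else 0.
have getE w (k : 'I_n) : get w k = w k 0 by rewrite /get valK.
pose u k := if (k < n)%N then get (usubmx w2) k
  else 'i%C ^+ (n + n) * (-1) ^+ (n + n - k) * get (usubmx w1) (n + n - k.+1)%N.
pose v k := if (k < n)%N then get (dsubmx w2) k
  else 'i%C ^+ (n + n) * (-1) ^+ (n + n - k).-1 * get (dsubmx w1) (n + n - k.+1)%N.
have sign_sq (k : nat) (z : R[i]) :
    'i%C ^+ (n + n) * (-1) ^+ k * ('i%C ^+ (n + n) * (-1) ^+ k * z) = z.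
  rewrite iX_even -exprD mulrA -exprD addnn -muln2 exprM sqrr_sign mul1r //.
have idx (k : 'I_n) : [/\ (n + n - k.+1 < n)%N = false, (n + n - (n + n - k.+1) = k.+1)%N
    & (n + n - (n + n - k.+1).+1 = k)%N].
  have kn := ltn_ord k; have kn2 := lt_add k; split.
  - by apply/negbTE; rewrite -leqNgt leq_subRL// leq_add2r.
  - by rewrite subKn.
  - by rewrite -subSn// subSS subKn// ltnW.
exists u, v; split.
  rewrite -[w1]vsubmxK; congr col_mx; apply/colP => k; rewrite mxE /u /v;
    by have [-> -> ->] := idx k; rewrite ?[k.+1.-1]/= getE sign_sq.
by rewrite -[w2]vsubmxK; congr col_mx; apply/colP => k; rewrite mxE /u /v ltn_ord getE.
Qed.

(** Uniqueness of inverses: the inverse of a unitary [K] is its conjugate transpose, and it equals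
    the conjugate of [K] exactly when [K] is symmetric. *)
Lemma unitary_symmetricP K : K \is unitarymx -> K *m map_mx conjc K = 1%:M <-> K = K^T.
Proof.
move=> /unitarymxP KK; split=> [KK'|Ks]; last by rewrite -[RHS]KK -Ks.
have Kinv := mulmx1C KK.
have : map_mx conjc K = map_mx conjc (K^T).
  by rewrite -[LHS]mul1mx -Kinv -mulmxA KK' mulmx1.
move=> /(congr1 (map_mx conjc)) /matrixP e; apply/matrixP => i j.
by have := e i j; rewrite !mxE !conjcK.
Qed.

(** Conjugating the condition replaces [K] by its conjugate and [s] by [- s]. Multiplication by [K]
    on the left turns the two factors into [1 - K] and [K + 1], which up to a global sign is the
    original condition for the conjugated values. *)
Lemma boundary_condition_conj s K : conjc s = - s -> K *m map_mx conjc K = 1%:M ->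
  forall u v, boundary_condition s K u v ->
  boundary_condition s K (fun k => conjc (u k)) (fun k => conjc (v k)).
Proof.
move=> sN KK u v; rewrite /boundary_condition boundary1_conj boundary2_conj.
move=> /(congr1 (map_mx conjc)); rewrite raddf0 map_mxD map_mxZ !map_mxM map_mxB map_mxD map_mx1 /= sN.
move=> /(congr1 (mulmx K)); rewrite mulmx0 mulmxDr -scalemxAr !mulmxA mulmxBr mulmxDr KK mulmx1.
move=> /(congr1 -%R); rewrite oppr0 opprD scaleNr opprK -mulNmx opprB [1%:M + K]addrC.
by [].
Qed.

(** The test pairs [s (K + 1) w] and [- (K - 1) w] satisfy the condition because [K - 1] and [K + 1]
    commute. For their conjugates the left-hand side equals [- 2 s (K conj(K) - 1) conj(w)], and
    unit vectors [w] give all columns. *)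
Lemma boundary_condition_conj_symmetric s K : conjc s = - s -> s != 0 ->
  (forall u v, boundary_condition s K u v ->
    boundary_condition s K (fun k => conjc (u k)) (fun k => conjc (v k))) ->
  K *m map_mx conjc K = 1%:M.
Proof.
move=> sN s0 Kconj.
suff H w : (K *m map_mx conjc K - 1%:M) *m map_mx conjc w = 0 :> 'cV_(n + n).
  apply/eqP; rewrite -subr_eq0; apply/eqP/matrixP => i j.
  have := H (delta_mx j 0) => /matrixP/(_ i 0).
  rewrite map_delta_mx -colE !mxE => ->//.
have [u [v [u1 v2]]] := boundary_values_exist (s *: ((K + 1%:M) *m w)) (- ((K - 1%:M) *m w)).
have bc : boundary_condition s K u v.
  rewrite /boundary_condition u1 v2 mulmxN scalerN -scalemxAr !mulmxA.
  have -> : (K - 1%:M) *m (K + 1%:M) = (K + 1%:M) *m (K - 1%:M).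
    rewrite !mulmxDr !mulmxDl !mulmxN !mulNmx !mul1mx !mulmx1; move: (K *m K) => M.
    by apply/matrixP => i j; rewrite !mxE; ring.
  by rewrite subrr.
have := Kconj _ _ bc.
rewrite /boundary_condition boundary1_conj boundary2_conj u1 v2.
rewrite map_mxZ !map_mxN !map_mxM map_mxB map_mxD map_mx1 /= sN.
set Kc := map_mx conjc K; set wc := map_mx conjc w.
rewrite -scalemxAr scaleNr mulmxN scalerN -opprD -scalerDr !mulmxA -mulmxDl.
move=> /eqP; rewrite oppr_eq0 scaler_eq0 (negbTE s0) /= => /eqP.
have -> : (K - 1%:M) *m (Kc + 1%:M) + (K + 1%:M) *m (Kc - 1%:M) =
    2%:R *: (K *m Kc - 1%:M).
  rewrite !mulmxDr !mulmxDl !mulmxN !mulNmx !mulmx1 !mul1mx scaler_nat mulr2n.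
  move: (K *m Kc) => M; apply/matrixP => i j; rewrite !mxE; ring.
rewrite -scalemxAl => /eqP; rewrite scaler_eq0 pnatr_eq0 /= => /eqP ->//.
Qed.

End BoundaryConditions.

Theorem theorem4 (R : realType) (a b : R) (n : nat)
    (A : R -> 'M[R[i]]_(n + n)) :
  a < b -> (2 <= n)%N ->
  shin_zettl a b A -> formally_self_adjoint a b A -> real_entries a b A ->
  [/\ real_operator (L_max a b A) /\ real_operator (L_min a b A),
      (forall T : set (L2 a b * L2 a b), L_min a b A `<=` T ->
         real_operator T ->
         max_dissipative (L2_ip a b) T \/ max_accumulative (@L2_ip R a b) T ->
         self_adjoint (L2_ip a b) T)
    & (forall K : 'M[R[i]]_(n + n), K \is unitarymx ->
         (real_operator (L_sub a b A K) <-> K = K^T) /\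
         (real_operator (L_sup a b A K) <-> K = K^T))].
Proof.
move=> ab n2 szA _ realA.
have m0 : (0 < n + n)%N by rewrite addn_gt0 (ltnW n2).
have iR := @iX_even_real R n.
have local_real (s : R[i]) (K : 'M[R[i]]_(n + n)) : conjc s = - s -> s != 0 ->
    K \is unitarymx ->
    real_operator (qd_operator (a := a) (b := b) A
      (boundary_domain a b A (boundary_condition s K))) <-> K = K^T.
  move=> sN s0 Ku; rewrite -(unitary_symmetricP Ku); split=> [[_ LJ]|KK].
    apply: (boundary_condition_conj_symmetric sN s0) => u v uv.
    (* Realness of the operator speaks only of functions in its domain; surjectivity of the boundary
       values turns it into a statement about all [u] and [v] satisfying the condition. *)
    have [Y [F [YF FL2 Yuv]]] := boundary_values_realized ab m0 szA realA u v.
    have bcY : boundary_condition s K (fun k => Y k a) (fun k => Y k b).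
      by apply: boundary_condition_local uv => k km; have [] := Yuv k km.
    have [f fY] := L2_class_exists (abs_continuous_L2 ab (let: And3 Yac _ _ := YF in Yac _ m0)).
    have [g gF] : exists g : L2 a b, L2_class g (fun x => 'i%C ^+ (n + n) * F x).
      have [u0 u0F] := L2_class_exists FL2; exists ('i%C ^+ (n + n) *: u0 + 0).
      have [z z0] := L2_class_exists (L2_fun_cst0 a b).
      have zz := L2_class_lin (-1) z0 z0; rewrite scaleN1r addNr in zz.
      apply: L2_class_ae (L2_class_lin _ u0F zz) _; apply: aeW => x _.
      by rewrite !mulr0 !addr0.
    have Tfg : qd_operator (a := a) (b := b) A
        (boundary_domain a b A (boundary_condition s K)) (f, g).
      apply/(qd_operatorP ab m0 szA (@boundary_condition_local _ _ s K)).
      by exists Y, F.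
    have := qd_operator_conj_boundary ab m0 szA realA (@boundary_condition_local _ _ s K)
      YF fY (LJ _ _ Tfg).
    apply: boundary_condition_local => k km; by have [e1 e2] := Yuv k km; rewrite ?e1 ?e2.
  apply: (@qd_operator_real _ _ _ _ A ab m0 szA realA (boundary_condition s K)).
  - exact: boundary_condition_local.
  - exact: boundary_condition0.
  - by move=> *; exact: boundary_condition_lin.
  - exact: iR.
  - exact: boundary_condition_conj.
split.
- split.
    have -> : L_max a b A = qd_operator A (boundary_domain a b A (fun _ _ => True)).
      by congr qd_operator; apply/seteqP; split=> [y ymax|y []].
    exact: qd_operator_real.
  apply: (@qd_operator_real _ _ _ _ A ab m0 szA realA
    (fun u v => forall k, (k < n + n)%N -> u k = 0 /\ v k = 0)) => //.
  - by move=> u u' v v' uu' vv' uv k km; rewrite -uu'// -vv'//; exact: uv.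
  - move=> c u v u' v' uv uv' k km; have [-> ->] := uv k km; have [-> ->] := uv' k km.
    by rewrite !mulr0 addr0.
  - by move=> u v uv k km; have [-> ->] := uv k km; rewrite conjc0.
- move=> T _; exact: L2_real_max_self_adjoint.
move=> K Ku; split; first by apply: local_real => //; rewrite ?neq0Ci//; apply/eqP; rewrite eq_complex /= oppr0 !eqxx.
have -> : L_sup a b A K = qd_operator A (boundary_domain a b A (boundary_condition (- 'i%C) K)).
  by congr qd_operator; apply/seteqP; split=> y [ymax ybc]; split=> //; move: ybc;
    rewrite /boundary_condition scaleNr.
apply: local_real => //; first by rewrite rmorphN /=; congr (- _); apply/eqP; rewrite eq_complex /= oppr0 !eqxx.
by rewrite oppr_eq0 eq_complex /= oner_eq0 andbF.
Qed.
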